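(* Let $B$ be a bialgebra over a field $k$. Then the collection $\mathcal{C}$ of all $B$-cocleft right $B$-module coalgebras is an idempotent radical class of $\mathbf{Coalg}\text{-}B$.
   Context: All algebras and coalgebras are over a field $k$ and $\otimes=\otimes_k$. A (right) $B$-module coalgebra is a coalgebra $C$ which is a right $B$-module such that $\Delta:C\to C\otimes C$ and $\varepsilon:C\to k$ are $B$-module maps ($C\otimes C$ with the diagonal $B$-action, $k$ the trivial module). $\mathbf{Coalg}\text{-}B$ is the category of right $B$-module coalgebras. A $B$-submodule coalgebra of $C$ is a subcoalgebra invariant under the $B$-action. For subspaces $X,Y\subseteq C$, $X\wedge Y=\Delta^{-1}(X\otimes C+C\otimes Y)$. For a collection $\mathcal{R}$ of $B$-module coalgebras, a member of $\mathcal{R}$ is called an $\mathcal{R}$-coalgebra, and a $B$-submodule coalgebra of $C$ which is a member of $\mathcal{R}$ is called an $\mathcal{R}$-subcoalgebra of $C$. A non-empty collection $\mathcal{R}$ of objects of $\mathbf{Coalg}\text{-}B$ is a radical class if: (R1) every $B$-submodule coalgebra of an $\mathcal{R}$-coalgebra is an $\mathcal{R}$-coalgebra; (R2) for any $C\in\mathbf{Coalg}\text{-}B$ and any family $\{C_i\}_{i\in I}$ of $\mathcal{R}$-subcoalgebras of $C$, $\sum_{i\in I}C_i\in\mathcal{R}$. It is idempotent if moreover: (R3) for any $C\in\mathbf{Coalg}\text{-}B$ and any $\mathcal{R}$-subcoalgebras $C_1,C_2$ of $C$, $C_1\wedge C_2\in\mathcal{R}$. A right $B$-module coalgebra $C$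 is $B$-cocleft if it admits a cointegral, i.e. a right $B$-module map $\gamma:C\to B$ which is convolution invertible (invertible in the convolution algebra $\mathrm{Hom}_k(C,B)$). *)

(* Defs.v *)
From HB Require Import structures.
From mathcomp Require Import all_boot all_algebra.
From mathcomp Require Import boolp classical_sets.

Set Implicit Arguments.
Unset Strict Implicit.
Unset Printing Implicit Defensive.

Import GRing.Theory.
Local Open Scope ring_scope.
Local Open Scope classical_set_scope.
Local Open Scope quotient_scope.

Definition bilin (k : fieldType) (V W U : lmodType k) (f : V -> W -> U) : Prop :=
  (forall w, linear (f ^~ w)) /\ (forall v, linear (f v)).

(* V (x) W: formal sums of pairs, two formal sums being identified when every
   bilinear map takes the same value on them.  The lemmas [tliftE] and
   [tensor_ext] below give the universal property. *)
Section Tensor.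
Variables (k : fieldType) (V W : lmodType k).
Implicit Types s t : seq (V * W).

Definition fsum (U : lmodType k) (f : V -> W -> U) s : U :=
  \sum_(p <- s) f p.1 p.2.

Definition tensor_rel s t : bool :=
  `[< forall (U : lmodType k) (f : V -> W -> U), bilin f -> fsum f s = fsum f t >].

Lemma tensor_rel_refl : reflexive tensor_rel.
Proof. by move=> s; apply/asboolP. Qed.

Lemma tensor_rel_sym : symmetric tensor_rel.
Proof.
by move=> s t; apply/asboolP/asboolP => h U f bf; rewrite (h U f bf).
Qed.

Lemma tensor_rel_trans : transitive tensor_rel.
Proof.
move=> t s u /asboolP st /asboolP tu; apply/asboolP => U f bf.
by rewrite (st U f bf) (tu U f bf).
Qed.

Canonical tensor_equiv :=
  EquivRel tensor_rel tensor_rel_refl tensor_rel_sym tensor_rel_trans.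

Definition tensor : Type := {eq_quot tensor_rel}.
HB.instance Definition _ := Choice.on tensor.
HB.instance Definition _ := EqQuotient.on tensor.

(* The linear map induced by f; meaningful only when f is bilinear. *)
Definition tlift (U : lmodType k) (f : V -> W -> U) (t : tensor) : U :=
  fsum f (repr t).

Lemma tensor_eqP (x y : tensor) :
  (forall (U : lmodType k) (f : V -> W -> U), bilin f -> tlift f x = tlift f y) ->
  x = y.
Proof.
move=> h; rewrite -[x]reprK -[y]reprK; apply/eqmodP/asboolP => U f bf.
exact: h.
Qed.

Lemma tlift_pi (U : lmodType k) (f : V -> W -> U) s :
  bilin f -> tlift f (\pi_tensor s) = fsum f s.
Proof.
move=> bf; have /eqmodP/asboolP : repr (\pi_tensor s) = s %[mod tensor].
  by rewrite reprK.
exact.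
Qed.

Definition tens (v : V) (w : W) : tensor := \pi_tensor [:: (v, w)].
Definition tzero : tensor := \pi_tensor [::].
Definition tadd (x y : tensor) : tensor := \pi_tensor (repr x ++ repr y).
Definition tscale (a : k) (x : tensor) : tensor :=
  \pi_tensor [seq (a *: p.1, p.2) | p <- repr x].
Definition topp (x : tensor) : tensor := tscale (- 1) x.

Lemma tliftE (U : lmodType k) (f : V -> W -> U) v w :
  bilin f -> tlift f (tens v w) = f v w.
Proof. by move=> bf; rewrite tlift_pi // /fsum big_seq1. Qed.

Lemma tlift0 (U : lmodType k) (f : V -> W -> U) : bilin f -> tlift f tzero = 0.
Proof. by move=> bf; rewrite tlift_pi // /fsum big_nil. Qed.

Lemma tliftD (U : lmodType k) (f : V -> W -> U) x y :
  bilin f -> tlift f (tadd x y) = tlift f x + tlift f y.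
Proof. by move=> bf; rewrite tlift_pi // /fsum big_cat. Qed.

Lemma tliftZ (U : lmodType k) (f : V -> W -> U) a x :
  bilin f -> tlift f (tscale a x) = a *: tlift f x.
Proof.
move=> bf; rewrite tlift_pi // /fsum big_map scaler_sumr.
by apply: eq_bigr => p _ /=; rewrite (scalable_linear (bf.1 p.2)).
Qed.

Fact taddA : associative tadd.
Proof. by move=> x y z; apply: tensor_eqP => U f bf; rewrite !tliftD // addrA. Qed.

Fact taddC : commutative tadd.
Proof. by move=> x y; apply: tensor_eqP => U f bf; rewrite !tliftD // addrC. Qed.

Fact tadd0 : left_id tzero tadd.
Proof.
by move=> x; apply: tensor_eqP => U f bf; rewrite tliftD // tlift0 // add0r.
Qed.

Fact taddN : left_inverse tzero topp tadd.
Proof.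
move=> x; apply: tensor_eqP => U f bf.
by rewrite tliftD // tliftZ // tlift0 // scaleN1r addNr.
Qed.

HB.instance Definition _ := GRing.isZmodule.Build tensor taddA taddC tadd0 taddN.

Fact tscaleA a b x : tscale a (tscale b x) = tscale (a * b) x.
Proof. by apply: tensor_eqP => U f bf; rewrite !tliftZ // scalerA. Qed.

Fact tscale1 : left_id 1 tscale.
Proof. by move=> x; apply: tensor_eqP => U f bf; rewrite tliftZ // scale1r. Qed.

Fact tscaleDr : right_distributive tscale +%R.
Proof.
move=> a x y; apply: tensor_eqP => U f bf.
by rewrite !(tliftD, tliftZ) // scalerDr.
Qed.

Fact tscaleDl x : {morph tscale^~ x : a b / a + b}.
Proof.
move=> a b; apply: tensor_eqP => U f bf.
by rewrite !(tliftD, tliftZ) // scalerDl.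
Qed.

HB.instance Definition _ :=
  GRing.Zmodule_isLmodule.Build k tensor tscaleA tscale1 tscaleDr tscaleDl.

Lemma tlift_linear (U : lmodType k) (f : V -> W -> U) : bilin f -> linear (tlift f).
Proof. by move=> bf a x y; rewrite tliftD // tliftZ. Qed.

Lemma tens_bilin : bilin tens.
Proof.
split=> [w a v v'|v a w w']; apply: tensor_eqP => U f bf;
  rewrite tlift_linear // !tliftE //; first exact: bf.1.
exact: bf.2.
Qed.

Lemma tensor_sum (x : tensor) : x = \sum_(p <- repr x) tens p.1 p.2.
Proof.
apply: tensor_eqP => U f bf.
have lf := tlift_linear bf.
have -> : tlift f (\sum_(p <- repr x) tens p.1 p.2) =
          \sum_(p <- repr x) tlift f (tens p.1 p.2).
  elim: (repr x) => [|p s ih]; first by rewrite !big_nil tlift0.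
  by rewrite !big_cons tliftD // ih.
by apply: eq_bigr => p _; rewrite tliftE.
Qed.

Lemma tensor_ext (U : lmodType k) (f g : tensor -> U) : linear f -> linear g ->
  (forall v w, f (tens v w) = g (tens v w)) -> f =1 g.
Proof.
move=> lf lg h x.
have sumE (F : tensor -> U) : linear F ->
    F x = \sum_(p <- repr x) F (tens p.1 p.2).
  move=> lF.
  have FD y z : F (y + z) = F y + F z by rewrite -[y]scale1r lF !scale1r.
  have F0 : F 0 = 0 by apply: (addrI (F 0)); rewrite -FD !addr0.
  rewrite [in LHS](tensor_sum x); elim: (repr x) => [|p s ih].
    by rewrite !big_nil.
  by rewrite !big_cons FD ih.
by rewrite (sumE f lf) (sumE g lg); apply: eq_bigr => p _.
Qed.

End Tensor.

Arguments tensor {k} (V W)%_type.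
Arguments tlift {k V W U} f t : simpl never.
Arguments tens {k V W} v w : simpl never.

Notation "V ⊗ W" := (tensor V W) (at level 40, left associativity) : type_scope.
Notation "v ⊗ w" := (tens v w) (at level 40, left associativity) : ring_scope.

Section TensorMaps.
Variable k : fieldType.

Definition tmap (V W V' W' : lmodType k) (f : V -> V') (g : W -> W') :
    V ⊗ W -> V' ⊗ W' :=
  tlift (fun v w => f v ⊗ g w).

Definition tassoc (U V W : lmodType k) : (U ⊗ V) ⊗ W -> U ⊗ (V ⊗ W) :=
  tlift (fun t w => tlift (fun u v => u ⊗ (v ⊗ w)) t).

(* (v ⊗ v', w ⊗ w') |-> f v w ⊗ g v' w' *)
Definition tmap2 (V W X V' W' X' : lmodType k)
    (f : V -> W -> X) (g : V' -> W' -> X') : V ⊗ V' -> W ⊗ W' -> X ⊗ X' :=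
  fun s t => tlift (fun v v' => tlift (fun w w' => f v w ⊗ g v' w') t) s.

End TensorMaps.

HB.mixin Record Lmodule_isCoalgebra (k : fieldType) C of GRing.Lmodule k C := {
  comult : {linear C -> (C ⊗ C)%type};
  counit : {linear C -> k^o};
  comultA : forall c : C,
    tassoc (tmap comult idfun (comult c)) = tmap idfun comult (comult c);
  counitl : forall c : C, tlift (fun x y => counit x *: y) (comult c) = c;
  counitr : forall c : C, tlift (fun x y => counit y *: x) (comult c) = c
}.

#[short(type="coalgType")]
HB.structure Definition Coalgebra (k : fieldType) :=
  {C of Lmodule_isCoalgebra k C & GRing.Lmodule k C}.

HB.mixin Record isBialgebra (k : fieldType) B
    of Coalgebra k B & GRing.Algebra k B := {
  comultM : forall a b : B,
    comult (a * b) = tmap2 *%R *%R (comult a) (comult b);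
  comult1 : comult (1 : B) = 1 ⊗ 1;
  counitM : forall a b : B, counit (a * b) = counit a * counit b;
  counit1 : counit (1 : B) = 1
}.

#[short(type="bialgType")]
HB.structure Definition Bialgebra (k : fieldType) :=
  {B of isBialgebra k B & Coalgebra k B & GRing.Algebra k B}.

HB.mixin Record Coalgebra_isModuleCoalgebra (k : fieldType) (B : bialgType k) C
    of Coalgebra k C := {
  act : C -> B -> C;
  act_bilin : bilin act;
  actA : forall c a b, act (act c a) b = act c (a * b);
  act1 : forall c, act c 1 = c;
  comult_act : forall c b,
    comult (act c b) = tmap2 act act (comult c) (comult b);
  counit_act : forall c b, counit (act c b) = counit c * counit b
}.

#[short(type="modCoalgType")]
HB.structure Definition ModuleCoalgebra (k : fieldType) (B : bialgType k) :=
  {C of Coalgebra_isModuleCoalgebra k B C & Coalgebra k C}.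

Section Subspaces.
Variable k : fieldType.

Definition subspace (V : lmodType k) (X : set V) : Prop :=
  submod_closed (mem X).

(* For subspaces X_i, the sum of the X_i is [addspan (\bigcup_i X_i)]. *)
Definition addspan (V : lmodType k) (A : set V) : set V :=
  [set v | exists2 s : seq V, (forall x, x \in s -> A x) & v = \sum_(x <- s) x].

(* The image of X ⊗ Y in V ⊗ W. *)
Definition tens_set (V W : lmodType k) (X : set V) (Y : set W) :
    set (V ⊗ W)%type :=
  addspan [set x ⊗ y | x in X & y in Y].

Lemma subspaceP (V : lmodType k) (X : set V) :
  subspace X <-> X 0 /\ forall a u v, X u -> X v -> X (a *: u + v).
Proof.
split=> [[X0 XL]|[X0 XL]]; split.
- exact: set_mem X0.
- by move=> a u v /mem_set Xu /mem_set Xv; apply: set_mem; exact: XL.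
- exact: mem_set X0.
- by move=> a u v /set_mem Xu /set_mem Xv; apply: mem_set; exact: XL.
Qed.

Lemma subspace_retraction (V : lmodType k) (X : set V) : subspace X ->
  exists r : {linear V -> V}, (forall v, X (r v)) /\ (forall x, X x -> r x = x).
Proof.
move=> /subspaceP[X0 XL].
have XZ a u : X u -> X (a *: u) by move=> Xu; rewrite -[_ *: _]addr0; exact: XL.
have XB u v : X u -> X v -> X (u - v).
  by move=> Xu Xv; rewrite addrC -scaleN1r; exact: XL.
pose Q (A : set V) :=
  (A 0 /\ forall a u v, A u -> A v -> A (a *: u + v)) /\
  (forall x, A x -> X x -> x = 0).
have [F FP Ftot|A [PA Amax]] := @Zorn_bigcup V [set A | A = set0 \/ Q A].
  have [[A [FA QA]]|nQ] := pselect (exists A, F A /\ Q A); last first.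
    left; apply/seteqP; split=> // x [A FA Ax]; apply: nQ; exists A; split=> //.
    by have [A0|//] := FP A FA; rewrite A0 in Ax.
  have FQ D x : F D -> D x -> Q D.
    by move=> FD Dx; have [D0|//] := FP D FD; rewrite D0 in Dx.
  right; split; last by move=> x [D FD Dx]; exact: (FQ D x FD Dx).2.
  split; first by exists A => //; exact: QA.1.1.
  move=> a u v [D FD Du] [E FE Ev].
  have [DE|ED] := Ftot D E FD FE.
    by exists E => //; apply: (FQ E v FE Ev).1.2 => //; exact: DE.
  by exists D => //; apply: (FQ D u FD Du).1.2 => //; exact: ED.
have [A0|[[A0 AL] AX]] := PA.
  exfalso; apply: (Amax [set 0]).
    by rewrite A0; split=> [x //|/(_ 0 erefl)].
  right; split=> //; split=> // a u v -> ->.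
  by rewrite /= scaler0 addr0.
have AZ a u : A u -> A (a *: u) by move=> Au; rewrite -[_ *: _]addr0; exact: AL.
have AB u v : A u -> A v -> A (u - v).
  by move=> Au Av; rewrite addrC -scaleN1r; exact: AL.
have ex v : exists x, X x /\ A (v - x).
  apply: contrapT => nv.
  pose E := [set w | exists c u, A u /\ w = c *: v + u].
  apply: (Amax E); last first.
    right; split.
      split; first by exists 0, 0; rewrite scale0r addr0.
      move=> a _ _ [c [u [Au ->]]] [d [w [Aw ->]]].
      exists (a * c + d), (a *: u + w); split; first exact: AL.
      by rewrite scalerDr scalerA scalerDl addrACA.
    move=> _ [c [u [Au ->]]] Xw.
    have [c0|c0] := eqVneq c 0.
      by move: Xw; rewrite c0 scale0r add0r; exact: AX.
    exfalso; apply: nv; exists (c^-1 *: (c *: v + u)); split; first exact: XZ.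
    rewrite scalerDr scalerA mulVf // scale1r opprD addrA subrr add0r -scalerN.
    by apply: AZ; rewrite -[- u]add0r; exact: AB.
  split=> [u Au|EA]; first by exists 0, u; rewrite scale0r add0r.
  apply: nv; exists 0; split=> //; rewrite subr0; apply: EA.
  by exists 1, 0; rewrite scale1r addr0.
have [r rP] := choice ex.
have uniq v x : X x -> A (v - x) -> r v = x.
  move=> Xx Ax; have [Xr Ar] := rP v; apply/eqP; rewrite -subr_eq0; apply/eqP.
  apply: AX; last exact: XB.
  by have := AB _ _ Ax Ar; rewrite opprB addrC addrA subrK.
have lr : linear r.
  move=> a u v; have [Xu Au] := rP u; have [Xv Av] := rP v.
  apply: uniq; first exact: XL.
  by rewrite opprD addrACA -scalerBr; exact: AL.
pose rl : {linear V -> V} :=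
  HB.pack r (GRing.isLinear.Build k V V *:%R r lr).
exists rl; split=> [v|x Xx]; first exact: (rP v).1.
by apply: uniq => //; rewrite subrr.
Qed.

End Subspaces.

Section TensorMapTheory.
Variable k : fieldType.
Implicit Types U V W X : lmodType k.

Lemma tmap_bilin V W V' W' (f : {linear V -> V'}) (g : {linear W -> W'}) :
  bilin (fun v w => f v ⊗ g w).
Proof.
by split=> [w a v v'|v a w w']; rewrite linearP;
   [rewrite (tens_bilin _ _).1|rewrite (tens_bilin _ _).2].
Qed.

Lemma tmapE V W V' W' (f : {linear V -> V'}) (g : {linear W -> W'}) v w :
  tmap f g (v ⊗ w) = f v ⊗ g w.
Proof. exact: (tliftE _ _ (tmap_bilin f g)). Qed.

Lemma tmap_linear V W V' W' (f : {linear V -> V'}) (g : {linear W -> W'}) :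
  linear (tmap f g).
Proof. exact: tlift_linear (tmap_bilin f g). Qed.

HB.instance Definition _ V W V' W' (f : {linear V -> V'}) (g : {linear W -> W'}) :=
  GRing.isLinear.Build k (V ⊗ W)%type (V' ⊗ W')%type *:%R (tmap f g)
    (tmap_linear f g).

Lemma tassoc_bilin1 U V W (w : W) : bilin (fun (u : U) (v : V) => u ⊗ (v ⊗ w)).
Proof.
split=> [v a u u'|u a v v']; first by rewrite (tens_bilin _ _).1.
by rewrite (tens_bilin _ _).1 (tens_bilin _ _).2.
Qed.

Lemma tassoc_bilin U V W :
  bilin (fun (t : U ⊗ V) (w : W) => tlift (fun u v => u ⊗ (v ⊗ w)) t).
Proof.
split=> [w|t a w w']; first exact: tlift_linear (@tassoc_bilin1 U V W w).
rewrite /tlift /fsum scaler_sumr -big_split; apply: eq_bigr => p _ /=.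
by rewrite !(tens_bilin _ _).2.
Qed.

Lemma tassocE U V W (u : U) (v : V) (w : W) :
  tassoc ((u ⊗ v) ⊗ w) = u ⊗ (v ⊗ w).
Proof.
rewrite /tassoc (tliftE _ _ (tassoc_bilin U V W)).
exact: (tliftE _ _ (@tassoc_bilin1 U V W w)).
Qed.

Lemma tassoc_linear U V W : linear (@tassoc k U V W).
Proof. exact: tlift_linear (tassoc_bilin U V W). Qed.

HB.instance Definition _ U V W :=
  GRing.isLinear.Build k ((U ⊗ V) ⊗ W)%type (U ⊗ (V ⊗ W))%type *:%R
    (@tassoc k U V W) (@tassoc_linear U V W).

Lemma tmap2_bilin1 V W X (V' W' X' : lmodType k) (f : V -> W -> X) (g : V' -> W' -> X') v v' :
  bilin f -> bilin g -> bilin (fun w w' => f v w ⊗ g v' w').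
Proof.
move=> bf bg; split=> [w' a w u|w a w' u'].
  by rewrite bf.2 (tens_bilin _ _).1.
by rewrite bg.2 (tens_bilin _ _).2.
Qed.

Lemma tmap2_bilin2 V W X (V' W' X' : lmodType k) (f : V -> W -> X) (g : V' -> W' -> X') t :
  bilin f -> bilin g ->
  bilin (fun v v' => tlift (fun w w' => f v w ⊗ g v' w') t).
Proof.
move=> bf bg; split=> [v' a v u|v a v' u'];
  rewrite /tlift /fsum scaler_sumr -big_split; apply: eq_bigr => p _ /=.
  by rewrite bf.1 (tens_bilin _ _).1.
by rewrite bg.1 (tens_bilin _ _).2.
Qed.

Lemma tmap2_bilin V W X (V' W' X' : lmodType k) (f : V -> W -> X) (g : V' -> W' -> X') :
  bilin f -> bilin g -> bilin (tmap2 f g).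
Proof.
move=> bf bg; split=> [t|s a t t'].
  exact: tlift_linear (tmap2_bilin2 t bf bg).
rewrite /tmap2 /(tlift _ s) /fsum scaler_sumr -big_split.
apply: eq_bigr => p _ /=.
exact: (tlift_linear (tmap2_bilin1 p.1 p.2 bf bg)).
Qed.

Lemma tmap2E V W X (V' W' X' : lmodType k) (f : V -> W -> X) (g : V' -> W' -> X') v v' w w' :
  bilin f -> bilin g -> tmap2 f g (v ⊗ v') (w ⊗ w') = f v w ⊗ g v' w'.
Proof.
move=> bf bg; rewrite /tmap2 (tliftE _ _ (tmap2_bilin2 _ bf bg)).
exact: (tliftE _ _ (tmap2_bilin1 _ _ bf bg)).
Qed.

End TensorMapTheory.

Section SubmoduleCoalgebra.
Variables (k : fieldType) (B : bialgType k) (C : modCoalgType B) (X : set C).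

Definition submodule_coalgebra : Prop :=
  [/\ subspace X,
      forall c, X c -> tens_set X X (comult c) &
      forall c b, X c -> X (act c b)].

Variable hX : submodule_coalgebra.

(* [hX] is a phantom argument, which lets HB infer closedness from the predicate. *)
Definition subc_pred : {pred C} := let _ := hX in fun x => x \in X.

Fact subc_pred_closed : subsemimod_closed subc_pred.
Proof. by have [[X0 XL] _ _] := hX; apply: GRing.submod_closed_semi; split. Qed.

HB.instance Definition _ :=
  GRing.isSubmodClosed.Build k C subc_pred subc_pred_closed.

Definition subc : Type := {x : C | subc_pred x}.

HB.instance Definition _ := SubChoice.on subc.
HB.instance Definition _ := [SubChoice_isSubLmodule of subc by <:].

Lemma subcP (x : subc) : X (val x).
Proof. by apply: set_mem; exact: (valP x). Qed.

Lemma subc_retraction :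
  exists r : {linear C -> subc}, forall x : subc, r (val x) = x.
Proof.
have [sX _ _] := hX; have [r [rX rid]] := subspace_retraction sX.
pose r' (c : C) : subc := Sub (r c) (mem_set (rX c)).
have r'L : linear r' by move=> a u v; apply: val_inj; rewrite /= linearP.
pose rl : {linear C -> subc} :=
  HB.pack r' (GRing.isLinear.Build k C subc *:%R r' r'L).
exists rl => x.
by apply: val_inj; exact: (rid _ (subcP x)).
Qed.

Definition subc_proj : {linear C -> subc} := projT1 (cid subc_retraction).

Lemma subc_projK (x : subc) : subc_proj (val x) = x.
Proof. exact: (projT2 (cid subc_retraction)). Qed.

Lemma subc_projE (c : C) : X c -> val (subc_proj c) = c.
Proof.
by move=> Xc; rewrite (subc_projK (Sub c (mem_set Xc) : subc)).
Qed.

(* The comultiplication of C corestricted to X; [subc_comultE] says that it is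
   the one induced by C, hence does not depend on the chosen projection. *)
Definition subc_comult : subc -> subc ⊗ subc :=
  fun x => tmap subc_proj subc_proj (comult (val x)).
Definition subc_counit : subc -> k^o := fun x => counit (val x).
Definition subc_act (x : subc) (b : B) : subc := subc_proj (act (val x) b).

Fact subc_comult_linear : linear subc_comult.
Proof. by move=> a x y; rewrite /subc_comult !linearP. Qed.

HB.instance Definition _ :=
  GRing.isLinear.Build k subc (subc ⊗ subc)%type *:%R subc_comult
    subc_comult_linear.

Fact subc_counit_linear : linear subc_counit.
Proof. by move=> a x y; rewrite /subc_counit linearP. Qed.

HB.instance Definition _ :=
  GRing.isLinear.Build k subc k^o *:%R subc_counit subc_counit_linear.

Local Notation incl := (\val : {linear subc -> C}).

Lemma subc_comultE (x : subc) :
  tmap \val \val (subc_comult x) = comult (val x).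
Proof.
have [_ XD _] := hX.
have [s sX E] := XD _ (subcP x); rewrite /subc_comult E.
rewrite (linear_sum (tmap subc_proj subc_proj)) (linear_sum (tmap incl incl)).
rewrite !big_seq; apply: eq_bigr => t /sX[u Xu [v Xv <-]].
suff : tmap incl incl (tmap subc_proj subc_proj (u ⊗ v)) = u ⊗ v by [].
rewrite (tmapE subc_proj subc_proj) (tmapE incl incl).
by congr (_ ⊗ _); exact: subc_projE.
Qed.

Lemma subc_actE (x : subc) b : val (subc_act x b) = act (val x) b.
Proof. by have [_ _ XB] := hX; apply/subc_projE/XB/subcP. Qed.

Local Notation incl2 :=
  (tmap incl incl : {linear (subc ⊗ subc)%type -> (C ⊗ C)%type}).

Lemma incl2K : cancel incl2 (tmap subc_proj subc_proj).
Proof.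
apply: (tensor_ext (linearP (tmap subc_proj subc_proj \o incl2))
                   (linearP idfun)) => y z /=.
by rewrite (tmapE incl incl) (tmapE subc_proj subc_proj) !subc_projK.
Qed.

Fact subc_comultA (x : subc) :
  tassoc (tmap subc_comult idfun (subc_comult x)) =
  tmap idfun subc_comult (subc_comult x).
Proof.
pose inc3 : {linear (subc ⊗ (subc ⊗ subc))%type -> (C ⊗ (C ⊗ C))%type} :=
  tmap incl incl2.
pose pr3 : {linear (C ⊗ (C ⊗ C))%type -> (subc ⊗ (subc ⊗ subc))%type} :=
  tmap subc_proj (tmap subc_proj subc_proj).
have pr3K : cancel inc3 pr3.
  apply: (tensor_ext (linearP (pr3 \o inc3)) (linearP idfun)) => y z /=.
  rewrite [inc3 _](tmapE incl incl2) [pr3 _](tmapE subc_proj (tmap _ _)).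
  by rewrite subc_projK; congr (_ ⊗ _); exact: incl2K.
apply: (can_inj pr3K).
have l1 t : inc3 (tmap idfun subc_comult t) = tmap idfun comult (incl2 t).
  move: t; apply: (tensor_ext (linearP (inc3 \o tmap idfun subc_comult))
                              (linearP (tmap idfun comult \o incl2))) => y z /=.
  rewrite (tmapE idfun subc_comult) [inc3 _](tmapE incl incl2).
  rewrite (tmapE incl incl) (tmapE idfun comult).
  by congr (_ ⊗ _); exact: subc_comultE.
have l3 (w : subc) s : inc3 (tassoc (s ⊗ w)) = tassoc (incl2 s ⊗ val w).
  move: s; apply: tensor_ext => [a s s'|a s s'|u v].
  - by rewrite (tens_bilin _ _).1 !linearP.
  - by rewrite linearP (tens_bilin _ _).1 linearP.
  - rewrite [incl2 (u ⊗ v)](tmapE incl incl) !tassocE [inc3 _](tmapE incl incl2).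
    by congr (_ ⊗ _); exact: (tmapE incl incl).
have l2 t : inc3 (tassoc (tmap subc_comult idfun t)) =
            tassoc (tmap comult idfun (incl2 t)).
  move: t; apply: (tensor_ext
    (linearP (inc3 \o (@tassoc k subc subc subc \o tmap subc_comult idfun)))
    (linearP (@tassoc k C C C \o (tmap comult idfun \o incl2)))) => y z /=.
  rewrite (tmapE subc_comult idfun) l3 (tmapE incl incl).
  rewrite (tmapE comult idfun); congr (tassoc (_ ⊗ _)); exact: subc_comultE.
by rewrite l1 l2 [incl2 _]subc_comultE comultA.
Qed.

Lemma counit_scale_bilinl (V W : lmodType k) (e : {linear V -> k^o}) :
  bilin (fun (x : V) (y : W) => e x *: y).
Proof.
split=> [y a u v|x a u v]; first by rewrite linearP scalerDl scalerA.
by rewrite scalerDr !scalerA mulrC.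
Qed.

Lemma counit_scale_bilinr (V W : lmodType k) (e : {linear W -> k^o}) :
  bilin (fun (x : V) (y : W) => e y *: x).
Proof.
split=> [y a u v|x a u v]; last by rewrite linearP scalerDl scalerA.
by rewrite scalerDr !scalerA mulrC.
Qed.

Fact subc_counitl (x : subc) :
  tlift (fun y z => subc_counit y *: z) (subc_comult x) = x.
Proof.
apply: val_inj; rewrite -[in RHS](counitl (val x)) -subc_comultE.
have bs := @counit_scale_bilinl subc subc subc_counit.
have bC := @counit_scale_bilinl C C counit.
move: (subc_comult x); apply: tensor_ext => [a s t|a s t|u v].
- by rewrite (tlift_linear bs) linearP.
- by rewrite (linearP (tmap incl incl)) (tlift_linear bC).
- by rewrite (tliftE _ _ bs) (tmapE incl incl) (tliftE _ _ bC) linearZ.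
Qed.

Fact subc_counitr (x : subc) :
  tlift (fun y z => subc_counit z *: y) (subc_comult x) = x.
Proof.
apply: val_inj; rewrite -[in RHS](counitr (val x)) -subc_comultE.
have bs := @counit_scale_bilinr subc subc subc_counit.
have bC := @counit_scale_bilinr C C counit.
move: (subc_comult x); apply: tensor_ext => [a s t|a s t|u v].
- by rewrite (tlift_linear bs) linearP.
- by rewrite (linearP (tmap incl incl)) (tlift_linear bC).
- by rewrite (tliftE _ _ bs) (tmapE incl incl) (tliftE _ _ bC) linearZ.
Qed.

HB.instance Definition _ :=
  Lmodule_isCoalgebra.Build k subc subc_comultA subc_counitl subc_counitr.

Fact subc_act_bilin : bilin subc_act.
Proof.
have [bl br] := @act_bilin k B C.
split=> [b a x y|x a b c]; apply: val_inj; rewrite subc_actE.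
  rewrite !(linearP incl) [incl (subc_act x b)]subc_actE.
  by rewrite [incl (subc_act y b)]subc_actE; exact: bl.
rewrite (linearP incl) [incl (subc_act x b)]subc_actE.
by rewrite [incl (subc_act x c)]subc_actE; exact: br.
Qed.

Fact subc_actA x a b : subc_act (subc_act x a) b = subc_act x (a * b).
Proof. by apply: val_inj; rewrite !subc_actE actA. Qed.

Fact subc_act1 x : subc_act x 1 = x.
Proof. by apply: val_inj; rewrite subc_actE act1. Qed.

Fact subc_comult_act x b :
  comult (subc_act x b) = tmap2 subc_act subc_act (comult x) (comult b).
Proof.
apply: (can_inj incl2K); rewrite [LHS]subc_comultE subc_actE comult_act.
have bs := tmap2_bilin subc_act_bilin subc_act_bilin.
have bC := tmap2_bilin (@act_bilin k B C) (@act_bilin k B C).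
rewrite -[comult (val x)]subc_comultE; symmetry.
rewrite -[comult x]/(subc_comult x).
move: (subc_comult x); apply: tensor_ext => [a s t|a s t|u v].
- by rewrite bs.1 linearP.
- by rewrite linearP bC.1.
move: (comult b); apply: tensor_ext => [a s t|a s t|c d].
- by rewrite bs.2 linearP.
- by rewrite bC.2.
rewrite (tmap2E _ _ _ _ subc_act_bilin subc_act_bilin).
rewrite [incl2 _](tmapE incl incl) (tmapE incl incl).
rewrite (tmap2E _ _ _ _ (@act_bilin k B C) (@act_bilin k B C)).
by congr (_ ⊗ _); exact: subc_actE.
Qed.

Fact subc_counit_act x b : counit (subc_act x b) = counit x * counit b.
Proof. by rewrite -[RHS](counit_act (val x)) -subc_actE. Qed.

HB.instance Definition _ :=
  Coalgebra_isModuleCoalgebra.Build k B subc subc_act_bilin subc_actA subc_act1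
    subc_comult_act subc_counit_act.

End SubmoduleCoalgebra.

Section RadicalClasses.
Variables (k : fieldType) (B : bialgType k).

Definition submodcoalg (C : modCoalgType B) (X : set C)
    (hX : submodule_coalgebra X) : modCoalgType B := subc hX.

Definition wedge (C : coalgType k) (X Y : set C) : set C :=
  [set c | exists s t : C ⊗ C,
     [/\ tens_set X setT s, tens_set setT Y t & comult c = s + t]].

Implicit Type R : modCoalgType B -> Prop.

Definition is_subcoalgebra_in R (C : modCoalgType B) (X : set C) : Prop :=
  exists hX : submodule_coalgebra X, R (submodcoalg hX).

Record radical_class R : Prop := RadicalClass {
  radical_nonempty : exists C, R C;
  radical_sub : forall (C : modCoalgType B) (X : set C)
    (hX : submodule_coalgebra X), R C -> R (submodcoalg hX);
  radical_sum : forall (C : modCoalgType B) (I : Type) (X : I -> set C),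
    (forall i, is_subcoalgebra_in R (X i)) ->
    is_subcoalgebra_in R (addspan (\bigcup_i X i))
}.

Record idempotent_radical_class R : Prop := IdempotentRadicalClass {
  idempotent_radical : radical_class R;
  radical_wedge : forall (C : modCoalgType B) (X Y : set C),
    is_subcoalgebra_in R X -> is_subcoalgebra_in R Y ->
    is_subcoalgebra_in R (wedge X Y)
}.

Definition convolution (C : coalgType k) (f g : C -> B) (c : C) : B :=
  tlift (fun x y => f x * g y) (comult c).

Definition convolution_invertible (C : coalgType k) (f : {linear C -> B}) : Prop :=
  exists g : {linear C -> B}, forall c,
    convolution f g c = (counit c : k) *: (1 : B) /\
    convolution g f c = (counit c : k) *: (1 : B).

Definition cointegral (C : modCoalgType B) (f : {linear C -> B}) : Prop :=
  (forall c b, f (act c b) = f c * b) /\ convolution_invertible f.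

Definition cocleft (C : modCoalgType B) : Prop :=
  exists f : {linear C -> B}, cointegral f.

End RadicalClasses.

(* Main.v *)
Require Import Defs.
From HB Require Import structures.
From mathcomp Require Import all_boot all_algebra.
From mathcomp Require Import boolp classical_sets.

Set Implicit Arguments.
Unset Strict Implicit.
Unset Printing Implicit Defensive.

Import GRing.Theory.
Local Open Scope ring_scope.
Local Open Scope classical_set_scope.

(* A cointegral on a submodule coalgebra X of C is represented by total linear
   maps f, g : C -> B whose convolution products are the counit on X only, so that
   cointegrals on different submodule coalgebras can be compared and glued.

   Sums.  Let f0 be a cointegral on E and f one on Y containing E, with inverse
   g.  Then f0 * g is invertible on E and satisfies phi(x b) = phi(x) eps(b), so
   it comes from a subcoalgebra of the quotient coalgebra Y / Y B^+.  Invertible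
   maps extend from any subcoalgebra to the whole coalgebra (see
   [extend_inverse]); multiplying the extension by f extends f0 from E to Y.
   Applied to E = Z /\ C_i and Y = C_i, this extends a cointegral on a maximal Z
   to Z + C_i.  No antipode is needed, thanks to b_1 g(x b_2) = eps(b) g(x).

   Extension of invertible maps.  For a maximal domain X of an extension,
   X /\ X = X in the wedge sense, since an inverse on X extends to the wedge
   square.  If X is proper, Jacobson density for a minimal right coideal not in X
   gives a functional e that vanishes on X and equals the counit on a subcoalgebra
   T not in X; then f * (eps - e) + e is an invertible extension to X + T.

   Wedges.  One may assume both subcoalgebras equal to some Z.  The quotient of
   the wedge W by Z is a Hopf module over Z, hence Z splits off W as a B-module
   and a cointegral extends to a B-linear map on W, which is still invertible. *)

(** * Linear algebra and tensor products *)

Section LinearAlgebra.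
Variable k : fieldType.
Implicit Types U V W : lmodType k.

Definition mklin V W (f : V -> W) (lf : linear f) : {linear V -> W} :=
  HB.pack f (GRing.isLinear.Build k V W *:%R f lf).

(** Two preimages under [h] of the same vector differ by an element of its kernel, which [g] kills,
    so arbitrary choices still give a linear map. With [g := idfun] this yields left inverses of
    injective maps. *)
Lemma lin_factor V U W (h : {linear V -> U}) (g : {linear V -> W}) :
  (forall v, h v = 0 -> g v = 0) ->
  exists s : {linear U -> W}, forall v, s (h v) = g v.
Proof.
move=> kerhg.
have sR : subspace (range h).
  apply/subspaceP; split; first by exists 0; rewrite ?linear0.
  move=> a _ _ [u _ <-] [v _ <-]; exists (a *: u + v) => //; exact: linearP.
have [r [rR rid]] := subspace_retraction sR.
have ex u : exists v, h v = r u by have [v _ e] := rR u; exists v.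
have [p pE] := choice ex.
have gp v w : h v = h w -> g v = g w.
  by move=> E; apply: subr0_eq; rewrite -linearB; apply: kerhg; rewrite linearB E subrr.
have lin : linear (g \o p).
  by move=> a u v; rewrite /= -linearP; apply: gp; rewrite pE !linearP !pE.
exists (mklin lin) => v /=; apply: gp; rewrite pE; apply: rid.
by exists v.
Qed.

Lemma subspace_sep V (X : set V) v : subspace X -> ~ X v ->
  exists f : {linear V -> k^o}, (forall x, X x -> f x = 0) /\ f v = 1.
Proof.
move=> sX nXv; have [r [rX rid]] := subspace_retraction sX.
pose q : {linear V -> V} := idfun \- r.
have qv0 : q v != 0.
  by apply: contra_not_neq nXv => /subr0_eq /= ->; exact: rX.
have hL : linear (fun a : k^o => a *: q v).
  by move=> a b c; rewrite scalerDl scalerA.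
pose h := mklin hL.
have [s sE] : exists s : {linear V -> k^o}, forall a, s (h a) = a.
  apply: (lin_factor (g := idfun)) => a /eqP.
  by rewrite /h /= scaler_eq0 (negPf qv0) orbF => /eqP.
exists (s \o q); split=> [x Xx|]; last by rewrite /= -[RHS]sE /h /= scale1r.
by rewrite /= rid // subrr linear0.
Qed.

Lemma functional_ext V (v w : V) :
  (forall f : {linear V -> k^o}, f v = f w) -> v = w.
Proof.
move=> h; apply: subr0_eq; apply: contrapT => vw.
have s0 : subspace [set 0 : V].
  by apply/subspaceP; split=> // a u z -> ->; rewrite scaler0 addr0.
have [f [_ ]] := subspace_sep s0 vw.
by rewrite linearB h subrr => /esym/eqP; rewrite oner_eq0.
Qed.

Lemma functional_sub V (X : set V) v : subspace X ->
  (forall f : {linear V -> k^o}, (forall x, X x -> f x = 0) -> f v = 0) -> X v.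
Proof.
move=> sX h; apply: contrapT => /(subspace_sep sX)[f [fX fv]].
by have := h f fX; rewrite fv => /eqP; rewrite oner_eq0.
Qed.

(** The difference [d] is extended from [Y] through the quotient by [X]: on [Y], the kernel of [q]
    is the intersection of [X] and [Y], where [d] vanishes. *)
Lemma linear_glue V W (X Y : set V) (f g : {linear V -> W}) :
  subspace X -> subspace Y -> (forall v, X v -> Y v -> f v = g v) ->
  exists h : {linear V -> W},
    (forall v, X v -> h v = f v) /\ (forall v, Y v -> h v = g v).
Proof.
move=> sX sY fg; have [p [pX pid]] := subspace_retraction sX.
have [r [rY rid]] := subspace_retraction sY.
pose q : {linear V -> V} := idfun \- p.
pose d : {linear V -> W} := g \- f.
have [s sE] : exists s : {linear V -> W},
    forall v, s ((q \o r) v) = (d \o r) v.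
  apply: lin_factor => v /= /subr0_eq rp; rewrite fg ?subrr //.
  by rewrite rp; exact: pX.
exists (f \+ (s \o q)); split=> v Xv /=.
  by rewrite pid // subrr linear0 addr0.
have := sE v; rewrite /= rid // => ->.
by rewrite addrC subrK.
Qed.

Lemma linear_extend V W (X : set V) (f : V -> W) : subspace X ->
  (forall a u v, X u -> X v -> f (a *: u + v) = a *: f u + f v) ->
  exists h : {linear V -> W}, forall v, X v -> h v = f v.
Proof.
move=> sX fL; have [p [pX pid]] := subspace_retraction sX.
have lin : linear (f \o p) by move=> a u v; rewrite /= linearP fL.
by exists (mklin lin) => v Xv /=; rewrite pid.
Qed.

(** Membership in a linear span, with one generator peeled off at a time so that proofs go by
    induction on the list. *)
Fixpoint fspan V (s : seq V) (v : V) : Prop :=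
  if s is x :: s' then exists a : k, fspan s' (v - a *: x) else v = 0.

Lemma fspan_map V W (f : {linear V -> W}) s v :
  fspan s v -> fspan (map f s) (f v).
Proof.
elim: s v => [v /= ->|x s ih v /= [a /ih]]; first by rewrite linear0.
by rewrite linearB linearZ_LR; exists a.
Qed.

Lemma fspan_sub V (X : set V) s v : subspace X -> (forall x, x \in s -> X x) ->
  fspan s v -> X v.
Proof.
move=> /subspaceP[X0 XL]; elim: s v => [v _ /= ->|x s ih v sX /= [a sv]] //.
rewrite -[v](subrK (a *: x)) addrC; apply: XL.
  by apply: sX; rewrite mem_head.
by apply: ih => // y ys; apply: sX; rewrite inE ys orbT.
Qed.

Lemma fspan0 V (s : seq V) : fspan s 0.
Proof. by elim: s => //= x s ih; exists 0; rewrite scale0r subr0. Qed.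

Lemma fspanP V (s : seq V) a u v : fspan s u -> fspan s v -> fspan s (a *: u + v).
Proof.
elim: s u v => [u v /= -> ->|x s ih u v /= [b su] [c sv]].
  by rewrite scaler0 addr0.
exists (a * b + c); suff -> : a *: u + v - (a * b + c) *: x =
  a *: (u - b *: x) + (v - c *: x) by exact: ih.
by rewrite scalerBr scalerDl scalerA opprD addrACA.
Qed.

Lemma fspan_mem V (s : seq V) x : x \in s -> fspan s x.
Proof.
elim: s => //= y s ih; rewrite inE => /predU1P[->|/ih sx].
  by exists 1; rewrite scale1r subrr; exact: fspan0.
by exists 0; rewrite scale0r subr0.
Qed.

Lemma fspan_subspace V (s : seq V) : subspace [set v | fspan s v].
Proof. by apply/subspaceP; split=> [|a u v]; [exact: fspan0|exact: fspanP]. Qed.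

(** Stands in for a dimension count: projecting along a generator [x] with [f x != 0] fixes the
    kernel of [f] and removes [x] from the list. *)
Lemma fspan_kernel V (s : seq V) (f : {linear V -> k^o}) u :
  fspan s u -> f u != 0 ->
  exists2 t : seq V, (size t < size s)%N &
    forall v, fspan s v -> f v = 0 -> fspan t v.
Proof.
elim: s u => [u /= ->|x s ih u /= [a su] fu]; first by rewrite linear0 eqxx.
have [fx0|fx0] := eqVneq (f x) 0.
  have fux : f (u - a *: x) != 0 by rewrite linearB linearZ_LR fx0 scaler0 subr0.
  have [t ts tP] := ih _ su fux; exists (x :: t) => // v [b sv] fv /=.
  by exists b; apply: tP => //; rewrite linearB linearZ_LR fx0 scaler0 fv subr0.
have lin : linear (fun v => v - (f v / f x) *: x).
  move=> c v w; rewrite linearP mulrDl scalerDl opprD addrACA scalerBr scalerA.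
  by rewrite -[c *: f v]/(c * f v) mulrA.
exists (map (mklin lin) s); first by rewrite size_map.
move=> v [b sv] fv; have := fspan_map (mklin lin) sv.
suff -> : mklin lin (v - b *: x) = v by [].
have fvb : f (v - b *: x) / f x = - b.
  by rewrite linearB linearZ_LR fv sub0r mulNr -[b *: f x]/(b * f x) mulfK.
by rewrite /= fvb scaleNr opprK subrK.
Qed.

(** Induction on the length of [s]: a nonzero [l] in [L] and a functional with [f l = 1] split off
    one generator, and the kernel of [f] in [L] lies in the span of a shorter list. *)
Lemma fspan_generators V (L : set V) (s : seq V) : subspace L ->
  (forall v, L v -> fspan s v) ->
  exists2 t : seq V, (forall x, x \in t -> L x) & forall v, L v -> fspan t v.
Proof.
have [n sn] := ubnP (size s); elim: n s L sn => // n ih s L sn sL Ls.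
have [[l [Ll l0]]|nL] := pselect (exists l, L l /\ l <> 0); last first.
  exists [::] => // v Lv /=; apply: contrapT => v0; apply: nL; by exists v.
have s0 : subspace [set 0 : V].
  by apply/subspaceP; split=> // a u z -> ->; rewrite scaler0 addr0.
have [f [_ fl]] := subspace_sep s0 l0.
have [|t ts tP] := fspan_kernel (Ls _ Ll) (f := f); first by rewrite fl oner_eq0.
have [L0 LL] := (subspaceP _).1 sL.
have [|||w wL Lw] := ih t [set v | L v /\ f v = 0].
- exact: leq_trans ts _.
- apply/subspaceP; split=> [|a u v [Lu fu] [Lv fv]]; first by rewrite /= linear0.
  by split; [exact: LL|rewrite linearP fu fv scaler0 addr0].
- by move=> v [Lv fv]; apply: tP => //; exact: Ls.
exists (l :: w) => [x|v Lv /=]; first by rewrite inE => /predU1P[->//|/wL[]].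
exists (f v); apply: Lw; split.
  by rewrite addrC -scaleNr; exact: LL.
by rewrite linearB linearZ_LR fl /= -[_ *: 1]/(f v * 1) mulr1 subrr.
Qed.

End LinearAlgebra.

(** * Bilinear maps, contractions and subspaces of tensor products *)

Section TensorSpaces.
Variable k : fieldType.
Implicit Types U V W : lmodType k.

Section Bilinear.
Variables (V W U : lmodType k) (F : V -> W -> U) (bF : bilin F).

Lemma bilinDl x x' y : F (x + x') y = F x y + F x' y.
Proof. by have := bF.1 y 1 x x'; rewrite !scale1r. Qed.

Lemma bilinDr x y y' : F x (y + y') = F x y + F x y'.
Proof. by have := bF.2 x 1 y y'; rewrite !scale1r. Qed.

Lemma bilin0l y : F 0 y = 0.
Proof. by apply: (addrI (F 0 y)); rewrite -bilinDl !addr0. Qed.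

Lemma bilin0r x : F x 0 = 0.
Proof. by apply: (addrI (F x 0)); rewrite -bilinDr !addr0. Qed.

Lemma bilinZl a x y : F (a *: x) y = a *: F x y.
Proof. by have := bF.1 y a x 0; rewrite bilin0l !addr0. Qed.

Lemma bilinZr a x y : F x (a *: y) = a *: F x y.
Proof. by have := bF.2 x a y 0; rewrite bilin0r !addr0. Qed.

Lemma bilinBl x x' y : F (x - x') y = F x y - F x' y.
Proof. by rewrite bilinDl -scaleN1r bilinZl scaleN1r. Qed.

Lemma bilinBr x y y' : F x (y - y') = F x y - F x y'.
Proof. by rewrite bilinDr -scaleN1r bilinZr scaleN1r. Qed.

End Bilinear.

Lemma tlift_add V W U (F : V -> W -> U) s t :
  bilin F -> tlift F (s + t) = tlift F s + tlift F t.
Proof. exact: tliftD. Qed.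

Lemma tlift_eq0 V W U (F : V -> W -> U) t :
  (forall x y, F x y = 0) -> tlift F t = 0.
Proof. by move=> F0; rewrite /tlift /fsum big1. Qed.

Lemma tlift_eq V W U (F G : V -> W -> U) t :
  (forall x y, F x y = G x y) -> tlift F t = tlift G t.
Proof. by move=> FG; apply: eq_bigr => p _; exact: FG. Qed.

Lemma linear_tlift V W U U' (h : {linear U -> U'}) (F : V -> W -> U) t :
  h (tlift F t) = tlift (fun x y => h (F x y)) t.
Proof. exact: linear_sum. Qed.

Lemma tlift_param V W U V' (F : V' -> V -> W -> U) t :
  (forall x y, linear (fun z => F z x y)) -> linear (fun z => tlift (F z) t).
Proof.
move=> lF a u v; rewrite /tlift /fsum scaler_sumr -big_split.
by apply: eq_bigr => p _; exact: lF.
Qed.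

Lemma tlift_exchange V W V' W' U (F : V -> W -> V' -> W' -> U) s t :
  tlift (fun x y => tlift (F x y) t) s =
  tlift (fun u v => tlift (fun x y => F x y u v) s) t.
Proof. exact: exchange_big. Qed.

Lemma bilin_comp V W U V' W' U' (h : {linear U -> U'}) (F : V -> W -> U)
    (f : {linear V' -> V}) (g : {linear W' -> W}) :
  bilin F -> bilin (fun x y => h (F (f x) (g y))).
Proof.
by move=> [F1 F2]; split=> [w|v] a x y; rewrite linearP ?F1 ?F2 linearP.
Qed.

Lemma tlift_tmap V W U V' W' (F : V -> W -> U)
    (f : {linear V' -> V}) (g : {linear W' -> W}) t : bilin F ->
  tlift F (tmap f g t) = tlift (fun x y => F (f x) (g y)) t.
Proof.
move=> bF; have bFfg := bilin_comp idfun f g bF.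
move: t; apply: tensor_ext => [a x y|a x y|v w].
- by rewrite linearP (tlift_linear bF).
- by rewrite (tlift_linear bFfg).
- by rewrite (tmapE f g) (tliftE _ _ bF) (tliftE _ _ bFfg).
Qed.

Lemma addspan_subspace V (A : set V) :
  (forall a v, A v -> A (a *: v)) -> subspace (addspan A).
Proof.
move=> AZ; apply/subspaceP; split; first by exists [::]; rewrite ?big_nil.
move=> a _ _ [s sA ->] [t tA ->]; exists ([seq a *: x | x <- s] ++ t).
  by move=> x; rewrite mem_cat => /orP[/mapP[y /sA Ay ->]|/tA//]; exact: AZ.
by rewrite big_cat big_map scaler_sumr.
Qed.

Lemma addspan_mem V (A : set V) v : A v -> addspan A v.
Proof.
by move=> Av; exists [:: v]; [move=> x; rewrite inE => /eqP->|rewrite big_seq1].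
Qed.

Lemma addspan_min V (A X : set V) : subspace X -> A `<=` X -> addspan A `<=` X.
Proof.
move=> /subspaceP[X0 XL] AX _ [s sA ->]; rewrite big_seq.
elim/big_ind: _ => // [u v Xu Xv|v /sA/AX//].
by rewrite -[u]scale1r; exact: XL.
Qed.

Lemma tens_set_subspace V W (X : set V) (Y : set W) :
  subspace X -> subspace (tens_set X Y).
Proof.
move=> /subspaceP[X0 XL]; apply: addspan_subspace => a _ [x Xx [y Yy <-]].
exists (a *: x); first by rewrite -[_ *: _]addr0; exact: XL.
by exists y => //; rewrite (bilinZl (tens_bilin V W)).
Qed.

Lemma tens_set_mem V W (X : set V) (Y : set W) x y :
  X x -> Y y -> tens_set X Y (x ⊗ y).
Proof. by move=> Xx Yy; apply: addspan_mem; exists x => //; exists y. Qed.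

Lemma tens_setS V W (X X' : set V) (Y Y' : set W) :
  X `<=` X' -> Y `<=` Y' -> tens_set X Y `<=` tens_set X' Y'.
Proof.
move=> XX YY _ [s sA ->]; exists s => // t /sA[x Xx [y Yy <-]].
by exists x; [exact: XX|exists y => //; exact: YY].
Qed.

Lemma tlift_local V W U (X : set V) (Y : set W) (F G : V -> W -> U) t :
  bilin F -> bilin G -> (forall x y, X x -> Y y -> F x y = G x y) ->
  tens_set X Y t -> tlift F t = tlift G t.
Proof.
move=> bF bG FG [s sXY ->].
have E (H : V -> W -> U) : bilin H ->
    tlift H (\sum_(x <- s) x) = \sum_(x <- s) tlift H x.
  by move=> bH; exact: (linear_sum (mklin (tlift_linear bH))).
rewrite !E // !big_seq; apply: eq_bigr => _ /sXY[x Xx [y Yy <-]].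
by rewrite !tliftE //; exact: FG.
Qed.

Lemma tlift_local0 V W U (X : set V) (Y : set W) (F : V -> W -> U) t :
  bilin F -> (forall x y, X x -> Y y -> F x y = 0) ->
  tens_set X Y t -> tlift F t = 0.
Proof.
move=> bF F0 XYt; rewrite (tlift_local (G := fun _ _ => 0) bF _ F0 XYt).
  exact: tlift_eq0.
by split=> [w|v] a x y; rewrite scaler0 addr0.
Qed.

Lemma tlift_tens V W (t : V ⊗ W) : tlift (fun x y => x ⊗ y) t = t.
Proof. by rewrite [RHS]tensor_sum. Qed.

Definition hitr V W (f : {linear W -> k^o}) : V ⊗ W -> V :=
  tlift (fun x y => f y *: x).
Definition hitl V W (f : {linear V -> k^o}) : V ⊗ W -> W :=
  tlift (fun x y => f x *: y).

Lemma hitr_bilin V W (f : {linear W -> k^o}) : bilin (fun (x : V) y => f y *: x).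
Proof. exact: counit_scale_bilinr. Qed.

Lemma hitl_bilin V W (f : {linear V -> k^o}) : bilin (fun x (y : W) => f x *: y).
Proof. exact: counit_scale_bilinl. Qed.

(** The coefficients of [w] are moved to the left entries by bilinearity. Quantifying over [F] gives
    one list that serves both for the tensor and for all its contractions. *)
Lemma merge_pairs V W (l : seq (V * W)) (v : V) (w : W) :
  fspan (map snd l) w ->
  exists2 m : seq (V * W), size m = size l & forall U (F : V -> W -> U), bilin F ->
    F v w + \sum_(p <- l) F p.1 p.2 = \sum_(p <- m) F p.1 p.2.
Proof.
elim: l w => [|[v1 w1] l ih] w /=.
  move=> ->; exists [::] => // U F bF; rewrite !big_nil addr0.
  exact: (bilin0r bF).
move=> [a /ih[m sm mP]]; exists ((v1 + a *: v, w1) :: m); first by rewrite /= sm.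
move=> U F bF; rewrite !big_cons /= -mP // (bilinBr bF) (bilinDl bF).
rewrite (bilinZr bF) (bilinZl bF) addrCA -addrA; congr (_ + _).
by rewrite addrA [a *: _ + _]addrC subrK.
Qed.

(** Induction on the length of a sum representing [t]. If the first right factor is a combination of
    the others, its term is merged into them; otherwise a functional isolating it shows that its
    left factor lies in [X]. *)
Lemma tens_set_hitr V W (X : set V) (t : V ⊗ W) : subspace X ->
  (forall f : {linear W -> k^o}, X (hitr f t)) -> tens_set X setT t.
Proof.
move=> sX; have [X0 XL] := (subspaceP _).1 sX.
have [T0 TL] := (subspaceP _).1 (tens_set_subspace (W := W) setT sX).
rewrite /hitr /tlift /fsum [X in _ -> tens_set _ _ X]tensor_sum.
move: (repr t) => l.
have [n ln] := ubnP (size l); elim: n l ln => // n ih [_ _|[v w] l ln].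
  by rewrite big_nil.
have [wl hl|wl hl] := pselect (fspan (map snd l) w).
  have [m sm mP] := merge_pairs v wl.
  rewrite big_cons /= mP; last exact: tens_bilin.
  apply: ih => [|f]; first by rewrite sm.
  by have /= <- := mP _ _ (hitr_bilin V f); have := hl f; rewrite big_cons.
have [f [fl fw]] := subspace_sep (fspan_subspace (map snd l)) wl.
have Xv : X v.
  have := hl f; rewrite big_cons /= fw scale1r big_seq big1 ?addr0 // => p pl.
  by rewrite fl ?scale0r //; apply: fspan_mem; exact: map_f.
rewrite big_cons -[_ ⊗ _]scale1r; apply: TL; first exact: tens_set_mem.
apply: ih => // g; have := hl g; rewrite big_cons /= => Xs.
by rewrite -[\sum_(_ <- _) _](addKr (g w *: v)) -scaleNr; exact: XL.
Qed.

Lemma tens_set_hitl V W (Y : set W) (t : V ⊗ W) : subspace Y ->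
  (forall f : {linear V -> k^o}, Y (hitl f t)) -> tens_set setT Y t.
Proof.
move=> sY hY; pose F (V' W' : lmodType k) (x : V') (y : W') := y ⊗ x.
have bF V' W' : bilin (@F V' W').
  by split=> [y|x]; [exact: (tens_bilin W' V').2|exact: (tens_bilin W' V').1].
have FK : tlift (@F W V) (tlift (@F V W) t) = t.
  move: t {hY}; apply: (tensor_ext
    (linearP (mklin (tlift_linear (bF W V)) \o mklin (tlift_linear (bF V W))))
    (linearP idfun)) => v w /=.
  by rewrite !tliftE.
have : tens_set Y setT (tlift (@F V W) t).
  apply: tens_set_hitr => // f; rewrite /hitr.
  have := linear_tlift (mklin (tlift_linear (hitr_bilin W f))) (@F V W) t => /= ->.
  have := hY f; congr (Y _); apply: tlift_eq => x y.
  by rewrite (tliftE _ _ (hitr_bilin W f)).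
rewrite -[X in _ -> tens_set _ _ X]FK.
move: (tlift (@F V W) t) => _ [s sY' ->].
exists [seq tlift (@F W V) u | u <- s] => [_ /mapP[u /sY'[y Yy [x _ <-]] ->]|].
  by rewrite tliftE //; exists x => //; exists y.
by rewrite big_map; exact: (linear_sum (mklin (tlift_linear (bF W V)))).
Qed.

Lemma tens_setI V W (X : set V) (Y : set W) t : subspace X -> subspace Y ->
  tens_set X setT t -> tens_set setT Y t -> tens_set X Y t.
Proof.
move=> sX sY tX tY; have bt := tens_bilin V W.
have [p [pX pid]] := subspace_retraction sX.
have [q [qY qid]] := subspace_retraction sY.
have -> : t = tlift (fun x y => p x ⊗ q y) t.
  rewrite -[LHS]tlift_tens; have bpq := bilin_comp idfun p q bt.
  transitivity (tlift (fun x y => p x ⊗ y) t).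
    apply: (tlift_local bt (bilin_comp idfun p idfun bt) _ tX) => x y Xx _ /=.
    by rewrite pid.
  apply: (tlift_local (bilin_comp idfun p idfun bt) bpq _ tY) => x y _ Yy /=.
  by rewrite qid.
have /subspaceP[T0 TL] := tens_set_subspace (V := V) (W := W) (X := X) Y sX.
rewrite /tlift /fsum; elim/big_ind: _ => // [u v Tu Tv|p' _].
  by rewrite -[u]scale1r; exact: TL.
exact: tens_set_mem.
Qed.

(** The left factors are split by [p] and its complement [q]. Contracting the second part with [f]
    and applying [g] pairs [t] with [f \o q] and [g], where [f \o q] vanishes on [X]. *)
Lemma tens_set_sum V W (X : set V) (Y : set W) (t : V ⊗ W) :
  subspace X -> subspace Y ->
  (forall (f : {linear V -> k^o}) (g : {linear W -> k^o}),
    (forall x, X x -> f x = 0) -> (forall y, Y y -> g y = 0) ->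
    tlift (fun x y => f x * g y) t = 0) ->
  exists s u, [/\ tens_set X setT s, tens_set setT Y u & t = s + u].
Proof.
move=> sX sY h; have bt := tens_bilin V W.
have [p [pX pid]] := subspace_retraction sX.
exists (tlift (fun x y => p x ⊗ y) t), (tlift (fun x y => (x - p x) ⊗ y) t).
split; last 1 first.
- rewrite -[LHS]tlift_tens /tlift /fsum -big_split; apply: eq_bigr => z _ /=.
  by rewrite (bilinBl bt) addrC subrK.
- have /subspaceP[T0 TL] := tens_set_subspace (V := V) (W := W) (X := X) setT sX.
  rewrite /tlift /fsum; elim/big_ind: _ => // [u v Tu Tv|z _].
    by rewrite -[u]scale1r; exact: TL.
  exact: tens_set_mem.
apply: tens_set_hitl => // f; apply: functional_sub => // g gY.
pose q : {linear V -> V} := idfun \- p.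
rewrite /hitl.
have /= -> := linear_tlift (mklin (tlift_linear (hitl_bilin W f)))
  (fun x y => (x - p x) ⊗ y) t.
rewrite linear_tlift -[RHS](h (f \o q) g) //; last first.
  by move=> x Xx /=; rewrite pid // subrr linear0.
apply: tlift_eq => x y.
by rewrite (tliftE _ _ (hitl_bilin W f)) linearZ_LR.
Qed.

End TensorSpaces.

(** * Convolution, subcoalgebras and wedges *)

Section Convolution.
Variables (k : fieldType) (D : coalgType k).
Implicit Types (H : algType k) (X Y : set D).

(** Coassociativity for Sweedler sums of a trilinear expression in c_1, c_2, c_3: both sides are the
    map induced by [F] on the triple tensor product, applied to the two sides of [comultA]. *)
Lemma coassoc_tlift (U : lmodType k) (F : D -> D -> D -> U) c :
  (forall y z, linear (fun x => F x y z)) ->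
  (forall x z, linear (fun y => F x y z)) ->
  (forall x y, linear (F x y)) ->
  tlift (fun x y => tlift (fun u v => F u v y) (comult x)) (comult c) =
  tlift (fun x y => tlift (F x) (comult y)) (comult c).
Proof.
move=> F1 F2 F3.
have bF x : bilin (F x) by split.
have bG : bilin (fun x => tlift (F x)).
  split=> [t|x]; last exact: tlift_linear (bF x).
  by apply: tlift_param => y z; exact: F1.
have bl z : bilin (fun x y => F x y z) by split.
have bL : bilin (fun x y => tlift (fun u v => F u v y) (comult x)).
  split=> [y a x x'|x]; first by rewrite linearP (tlift_linear (bl y)).
  by apply: tlift_param => u v; exact: F3.
have bR : bilin (fun x y => tlift (F x) (comult y)).
  split=> [y|x a y y']; last by rewrite linearP (tlift_linear (bF x)).
  by apply: tlift_param => u v; exact: F1.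
pose G := mklin (tlift_linear bG).
have El t : G (tassoc (tmap comult idfun t)) =
    tlift (fun x y => tlift (fun u v => F u v y) (comult x)) t.
  move: t; apply: (tensor_ext
    (linearP (G \o (@tassoc k D D D \o tmap comult idfun)))
    (tlift_linear bL)) => x y.
  rewrite (tliftE _ _ bL) [LHS]/= (tmapE comult idfun).
  move: (comult x); apply: (tensor_ext (f := fun s => G (tassoc (s ⊗ y))))
    => [a s t|a s t|u v].
  - by rewrite (tens_bilin _ _).1 !linearP.
  - by rewrite (tlift_linear (bl y)).
  - by rewrite (tliftE _ _ (bl y)) tassocE /G /= (tliftE _ _ bG) (tliftE _ _ (bF u)).
have Er t : G (tmap idfun comult t) = tlift (fun x y => tlift (F x) (comult y)) t.
  exact: (tlift_tmap idfun comult t bG).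
by rewrite -El -Er comultA.
Qed.

(** [convolution] with values in any algebra [H]: [H = k^o] gives the dual algebra of [D], and
    [H = B] the setting of cointegrals. *)
Definition conv H (f g : D -> H) (c : D) : H :=
  tlift (fun x y => f x * g y) (comult c).

Definition conv1 H (c : D) : H := (counit c : k) *: 1.

Lemma bilin_mul H : bilin (fun a b : H => a * b).
Proof.
by split=> [b|a] c x y; [rewrite mulrDl scalerAl|rewrite mulrDr scalerAr].
Qed.

Lemma conv_bilin H (f g : {linear D -> H}) : bilin (fun x y => f x * g y).
Proof. exact: (bilin_comp idfun f g (bilin_mul H)). Qed.

Fact conv_linear H (f g : {linear D -> H}) : linear (conv f g).
Proof. by move=> a x y; rewrite /conv linearP (tlift_linear (conv_bilin f g)). Qed.

HB.instance Definition _ H (f g : {linear D -> H}) :=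
  GRing.isLinear.Build k D H *:%R (conv f g) (conv_linear f g).

Fact conv1_linear H : linear (@conv1 H).
Proof. by move=> a x y; rewrite /conv1 linearP scalerDl scalerA. Qed.

HB.instance Definition _ H :=
  GRing.isLinear.Build k D H *:%R (@conv1 H) (@conv1_linear H).

Lemma convA H (f g h : {linear D -> H}) c :
  conv f (conv g h) c = conv (conv f g) h c.
Proof.
rewrite /conv; transitivity
  (tlift (fun x y => tlift (fun u v => f x * (g u * h v)) (comult y)) (comult c)).
  apply: tlift_eq => x y; pose m := mklin ((bilin_mul H).2 (f x)).
  exact: (linear_tlift m).
rewrite -coassoc_tlift => [|y z a u v|x z a u v|x y a u v]; first 1 last.
- by rewrite linearP mulrDl scalerAl.
- by rewrite linearP mulrDl mulrDr -scalerAl -scalerAr.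
- by rewrite linearP !mulrDr -!scalerAr.
apply: tlift_eq => x y; pose m := mklin ((bilin_mul H).1 (h y)).
rewrite [RHS](linear_tlift m) /=; apply: tlift_eq => u v; exact: mulrA.
Qed.

Lemma conv1f H (f : {linear D -> H}) c : conv (@conv1 H) f c = f c.
Proof.
rewrite -[in RHS](counitl c) linear_tlift; apply: tlift_eq => x y.
by rewrite /conv1 -scalerAl mul1r linearZ_LR.
Qed.

Lemma convf1 H (f : {linear D -> H}) c : conv f (@conv1 H) c = f c.
Proof.
rewrite -[in RHS](counitr c) linear_tlift; apply: tlift_eq => x y.
by rewrite /conv1 -scalerAr mulr1 linearZ_LR.
Qed.

Lemma convDl H (f g h : D -> H) c :
  conv (fun x => f x + g x) h c = conv f h c + conv g h c.
Proof.
rewrite /conv /tlift /fsum -big_split; apply: eq_bigr => p _ /=.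
by rewrite mulrDl.
Qed.

Lemma convDr H (f g h : D -> H) c :
  conv f (fun x => g x + h x) c = conv f g c + conv f h c.
Proof.
rewrite /conv /tlift /fsum -big_split; apply: eq_bigr => p _ /=.
by rewrite mulrDr.
Qed.

Lemma convNl H (f g : D -> H) c : conv (fun x => - f x) g c = - conv f g c.
Proof.
rewrite /conv /tlift /fsum -sumrN; apply: eq_bigr => p _ /=.
by rewrite mulNr.
Qed.

Lemma convNr H (f g : D -> H) c : conv f (fun x => - g x) c = - conv f g c.
Proof.
rewrite /conv /tlift /fsum -sumrN; apply: eq_bigr => p _ /=.
by rewrite mulrN.
Qed.

Lemma convZr H a (f g : D -> H) c : conv f (fun x => a *: g x) c = a *: conv f g c.
Proof.
rewrite /conv /tlift /fsum scaler_sumr; apply: eq_bigr => p _ /=.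
by rewrite scalerAr.
Qed.

Lemma conv_eq H (f f' g g' : D -> H) c : f =1 f' -> g =1 g' ->
  conv f g c = conv f' g' c.
Proof. by move=> ff gg; apply: tlift_eq => x y; rewrite ff gg. Qed.

Lemma hitr_conv (f g : {linear D -> k^o}) c : g (hitr f (comult c)) = conv g f c.
Proof.
rewrite /hitr linear_tlift; apply: tlift_eq => x y.
by rewrite linearZ_LR -[LHS]/(f y * g x) mulrC.
Qed.

Lemma hitl_conv (f g : {linear D -> k^o}) c : g (hitl f (comult c)) = conv f g c.
Proof.
by rewrite /hitl linear_tlift; apply: tlift_eq => x y; rewrite linearZ_LR.
Qed.

Definition vanish X (f : D -> k^o) : Prop := forall x, X x -> f x = 0.

Definition subcoalg X : Prop :=
  subspace X /\ forall c, X c -> tens_set X X (comult c).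

Lemma subcoalg_hitr X (f : {linear D -> k^o}) c :
  subcoalg X -> X c -> X (hitr f (comult c)).
Proof.
move=> [sX XD] Xc; apply: functional_sub => // g gX; rewrite hitr_conv.
apply: (tlift_local0 (conv_bilin g f) _ (XD _ Xc)) => x y /gX -> _.
by rewrite mul0r.
Qed.

Lemma subcoalg_hitl X (f : {linear D -> k^o}) c :
  subcoalg X -> X c -> X (hitl f (comult c)).
Proof.
move=> [sX XD] Xc; apply: functional_sub => // g gX; rewrite hitl_conv.
apply: (tlift_local0 (conv_bilin f g) _ (XD _ Xc)) => x y _ /gX ->.
by rewrite mulr0.
Qed.

Lemma subcoalgI X : subspace X ->
  (forall (f : {linear D -> k^o}) c, X c -> X (hitr f (comult c))) ->
  (forall (f : {linear D -> k^o}) c, X c -> X (hitl f (comult c))) -> subcoalg X.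
Proof.
move=> sX hr hl; split=> // c Xc; apply: tens_setI => //.
  by apply: tens_set_hitr => // f; exact: hr.
by apply: tens_set_hitl => // f; exact: hl.
Qed.

Lemma subcoalg_cap X Y : subcoalg X -> subcoalg Y -> subcoalg (X `&` Y).
Proof.
move=> cX cY; have [[X0 XL] [Y0 YL]] := ((subspaceP _).1 cX.1, (subspaceP _).1 cY.1).
apply: subcoalgI => [|f c [Xc Yc]|f c [Xc Yc]].
- apply/subspaceP; split=> // a u v [Xu Yu] [Xv Yv].
  by split; [exact: XL|exact: YL].
- by split; exact: subcoalg_hitr.
- by split; exact: subcoalg_hitl.
Qed.

Lemma subcoalg_addspan (I : Type) (X : I -> set D) :
  (forall i, subcoalg (X i)) -> subcoalg (addspan (\bigcup_i X i)).
Proof.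
move=> cX; have sS : subspace (addspan (\bigcup_i X i)).
  apply: addspan_subspace => a v [i _ Xv]; exists i => //.
  have /subspaceP[X0 XL] := (cX i).1.
  by rewrite -[_ *: _]addr0; exact: XL.
split=> // c [s sX ->]; rewrite linear_sum big_seq.
have /subspaceP[T0 TL] := tens_set_subspace (addspan (\bigcup_i X i)) sS.
elim/big_ind: _ => // [u v Tu Tv|x /sX[i _ Xx]].
  by rewrite -[u]scale1r; exact: TL.
have := (cX i).2 x Xx; apply: tens_setS => y Xy;
  by apply: addspan_mem; exists i.
Qed.

Lemma conv_local H X (f f' g g' : {linear D -> H}) c : subcoalg X ->
  (forall x, X x -> f x = f' x) -> (forall x, X x -> g x = g' x) -> X c ->
  conv f g c = conv f' g' c.
Proof.
move=> [_ XD] ff gg Xc.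
apply: (tlift_local (conv_bilin f g) (conv_bilin f' g') _ (XD _ Xc)) => x y Xx Xy.
by rewrite ff // gg.
Qed.

Definition inv_on H X (f g : {linear D -> H}) : Prop :=
  forall c, X c -> conv f g c = conv1 H c /\ conv g f c = conv1 H c.

Lemma inv_on_eq H X (f f' g g' : {linear D -> H}) : subcoalg X ->
  (forall x, X x -> f x = f' x) -> (forall x, X x -> g x = g' x) ->
  inv_on X f g -> inv_on X f' g'.
Proof.
move=> cX ff gg fg c Xc.
by rewrite -(conv_local cX ff gg Xc) -(conv_local cX gg ff Xc); exact: fg.
Qed.

Lemma inverse_unique H X (f g g' : {linear D -> H}) : subcoalg X ->
  (forall c, X c -> conv g f c = conv1 H c) ->
  (forall c, X c -> conv f g' c = conv1 H c) -> forall c, X c -> g c = g' c.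
Proof.
move=> cX gf fg' c Xc; rewrite -[LHS]convf1 -[RHS]conv1f.
rewrite -(conv_local cX (f := g) (g := conv f g') _ _ Xc) //.
by rewrite convA; apply: (conv_local cX).
Qed.

(** Dual description through [tens_set_sum]: the wedge becomes the annihilator of a product of two
    annihilators in the dual algebra, so that wedge arguments reduce to convolution of
    functionals. *)
Lemma wedgeP X Y c : subspace X -> subspace Y ->
  wedge X Y c <-> forall f g : {linear D -> k^o},
    vanish X f -> vanish Y g -> conv f g c = 0.
Proof.
move=> sX sY; split=> [[s [t [sXT tYT E]]] f g fX gY|h]; last first.
  by have [s [t st]] := tens_set_sum sX sY h; exists s, t.
have bfg := conv_bilin f g; rewrite /conv E tlift_add //.
rewrite (tlift_local0 bfg _ sXT) ?(tlift_local0 bfg _ tYT) ?addr0 //.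
  by move=> x y _ /gY ->; rewrite mulr0.
by move=> x y /fX -> _; rewrite mul0r.
Qed.

Lemma wedge_subspace X Y : subspace X -> subspace Y -> subspace (wedge X Y).
Proof.
move=> sX sY; apply/subspaceP; split=> [|a u v /wedgeP uW /wedgeP vW];
  apply/wedgeP => // f g fX gY; first by rewrite linear0.
by rewrite (linearP (conv f g)) /= uW // vW // scaler0 addr0.
Qed.

Lemma vanish_convl X (f g : {linear D -> k^o}) :
  subcoalg X -> vanish X g -> vanish X (conv f g).
Proof. by move=> cX gX c Xc; rewrite -hitl_conv gX //; exact: subcoalg_hitl. Qed.

Lemma vanish_convr X (f g : {linear D -> k^o}) :
  subcoalg X -> vanish X f -> vanish X (conv f g).
Proof. by move=> cX fX c Xc; rewrite -hitr_conv fX //; exact: subcoalg_hitr. Qed.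

(** Annihilators of subcoalgebras are two-sided ideals of the dual algebra, so the functional [h] of
    a contraction is absorbed into [f] or [g]. *)
Lemma wedge_subcoalg X Y : subcoalg X -> subcoalg Y -> subcoalg (wedge X Y).
Proof.
move=> cX cY; have [sX sY] := (cX.1, cY.1).
apply: subcoalgI => [|h c /wedgeP cW|h c /wedgeP cW].
- exact: wedge_subspace.
- apply/wedgeP => // f g fX gY; rewrite hitr_conv -convA.
  by apply: cW => //; exact: vanish_convr.
- apply/wedgeP => // f g fX gY; rewrite hitl_conv convA.
  by apply: cW => //; exact: vanish_convl.
Qed.

Lemma sub_wedge X Y : subcoalg X -> subspace Y -> X `<=` wedge X Y.
Proof.
move=> cX sY x Xx; apply/wedgeP => // [|f g fX _]; first exact: cX.1.
exact: (vanish_convr g cX fX).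
Qed.

Lemma wedgeS X X' Y Y' : X `<=` X' -> Y `<=` Y' -> wedge X Y `<=` wedge X' Y'.
Proof.
move=> XX YY c [s [t [sX tY E]]]; exists s, t; split=> //.
  by move: sX; exact: tens_setS.
by move: tY; exact: tens_setS.
Qed.

(* If f * g = 1 + u on [wedge X X] with u = 0 on X, then u * u = 0 there, so
   g * (1 - u) is a right inverse of f; symmetrically on the left. *)
Lemma wedge_inv H X (f g : {linear D -> H}) : subcoalg X -> inv_on X f g ->
  exists g' : {linear D -> H}, inv_on (wedge X X) f g'.
Proof.
move=> cX fg; have sX := cX.1.
have cW : subcoalg (wedge X X) by exact: wedge_subcoalg.
have nil (u : {linear D -> H}) c : (forall x, X x -> u x = 0) -> wedge X X c ->
    conv u u c = 0.
  move=> uX [s [t [sXT tYT E]]]; have bu := conv_bilin u u.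
  rewrite /conv E tlift_add //.
  rewrite (tlift_local0 bu _ sXT) ?(tlift_local0 bu _ tYT) ?addr0 //.
    by move=> x y _ /uX ->; rewrite mulr0.
  by move=> x y /uX -> _; rewrite mul0r.
pose u : {linear D -> H} := conv f g \- conv1 H.
pose v : {linear D -> H} := conv g f \- conv1 H.
have uX x : X x -> u x = 0 by move=> Xx; rewrite /u /= (fg x Xx).1 subrr.
have vX x : X x -> v x = 0 by move=> Xx; rewrite /v /= (fg x Xx).2 subrr.
have sq (w : {linear D -> H}) c : (forall x, X x -> w x = 0) -> wedge X X c ->
    conv (conv1 H \+ w) (conv1 H \- w) c = conv1 H c /\
    conv (conv1 H \- w) (conv1 H \+ w) c = conv1 H c.
  move=> wX Wc; split.
    rewrite [LHS]convDl conv1f [conv w _ c]convDr convf1 convNr nil //=.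
    by rewrite oppr0 addr0 subrK.
  rewrite [LHS]convDr convf1 [conv _ w c]convDl conv1f convNl nil //=.
  by rewrite oppr0 addr0 subrK.
have fgE : conv f g =1 (conv1 H \+ u) by move=> c; rewrite /u /= addrC subrK.
have gfE : conv g f =1 (conv1 H \+ v) by move=> c; rewrite /v /= addrC subrK.
pose r : {linear D -> H} := conv g (conv1 H \- u).
pose l : {linear D -> H} := conv (conv1 H \- v) g.
have fr c : wedge X X c -> conv f r c = conv1 H c.
  move=> Wc; rewrite /r convA -[RHS](sq u c uX Wc).1.
  exact: conv_eq.
have lf c : wedge X X c -> conv l f c = conv1 H c.
  move=> Wc; rewrite /l -convA -[RHS](sq v c vX Wc).2.
  exact: conv_eq.
exists r => c Wc; split; first exact: fr.
rewrite -(lf c Wc); apply: (conv_local cW) => // x Wx.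
by rewrite (inverse_unique cW lf fr Wx).
Qed.

End Convolution.

(** * Extension of convolution invertible maps *)

(** Zorn's lemma for partial linear maps, each represented by a domain and a total map. Total maps
    with the same restriction have to be identified, so the order is inclusion of graphs over the
    domains. *)
Lemma zorn_linear (k : fieldType) (V U : lmodType k)
    (good : set V -> {linear V -> U} -> Prop) (X0 : set V) (h0 : {linear V -> U}) :
  (forall X h, good X h -> subspace X) ->
  (forall X (h h' : {linear V -> U}), (forall x, X x -> h x = h' x) ->
    good X h -> good X h') ->
  (forall (F : set (set V)) h, F !=set0 -> total_on F subset ->
    (forall X, F X -> good X h) -> good (\bigcup_(X in F) X) h) ->
  good X0 h0 ->
  exists X h, [/\ good X h, X0 `<=` X, forall x, X0 x -> h x = h0 x &
    forall X' (h' : {linear V -> U}), good X' h' -> X `<=` X' ->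
      (forall x, X x -> h' x = h x) -> X' `<=` X].
Proof.
move=> gsub geq gchain g0.
pose gr (X : set V) (h : {linear V -> U}) : set (V * U) :=
  [set p | X p.1 /\ p.2 = h p.1].
(* Adjoining the graph of [h0] admits the empty set, which bounds the empty chain, and makes every
   maximal element extend [h0]. *)
pose P (G : set (V * U)) := exists X h, good X h /\ G `|` gr X0 h0 = gr X h.
have grS X h X' h' : gr X h `<=` gr X' h' ->
    X `<=` X' /\ forall x, X x -> h' x = h x.
  by move=> S; split=> x Xx; have [] := S (x, h x) (conj Xx erefl).
have [F FP Ftot|G [[X [h [gX E]]] Gmax]] := @Zorn_bigcup (V * U)%type P; last first.
  have [X0X h0h] : X0 `<=` X /\ forall x, X0 x -> h x = h0 x.
    by apply: grS; rewrite -E; exact: subsetUr.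
  exists X, h; split=> // X' h' gX' XX' h'h.
  apply: contrapT => nX'; apply: (Gmax (gr X' h')); last first.
    exists X', h'; split=> //; apply/setUidl => -[x u] [/= Xx ->].
    by split=> /=; [exact/XX'/X0X|rewrite h'h ?h0h //; exact: X0X].
  have GX : G `<=` gr X h by rewrite -E; exact: subsetUl.
  split=> [[x u] /GX[/= Xx ->]|S].
    by split=> /=; [exact: XX'|rewrite h'h].
  by apply: nX'; have [] := grS _ _ _ _ (subset_trans S GX).
have [[G0 FG0]|nF] := pselect (F !=set0); last first.
  exists X0, h0; split=> //; rewrite bigcup0 ?set0U // => G FG.
  by case: nF; exists G.
pose good_graph G X h := [/\ F G, good X h & G `|` gr X0 h0 = gr X h].
have ex G : F G -> exists X h, good_graph G X h.
  by move=> FG; have [X [h [gX E]]] := FP G FG; exists X, h.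
pose F' : set (set V) := [set X | exists G h, good_graph G X h].
have cmp G X h G' X' h' : good_graph G X h -> good_graph G' X' h' ->
    (X `<=` X' /\ forall x, X x -> h' x = h x) \/
    (X' `<=` X /\ forall x, X' x -> h x = h' x).
  move=> [FG gX E] [FG' gX' E'].
  have [S|S] := Ftot G G' FG FG'; [left|right]; apply: grS; rewrite -E -E';
    exact: setSU.
(* Comparability in the chain gives a common value; outside all domains the default is 0. The
   resulting [f] is linear on the union, and [linear_extend] turns it into a total linear map. *)
have exu x : exists u, forall G X h, good_graph G X h -> X x -> u = h x.
  have [[G [X [h [gG Xx]]]]|nx] := pselect (exists G X h, good_graph G X h /\ X x).
    exists (h x) => G' X' h' gG' X'x.
    by have [[_ ->]|[_ ->]] := cmp _ _ _ _ _ _ gG gG'.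
  by exists 0 => G X h gG Xx; case: nx; exists G, X, h.
have [f fP] := choice exu.
have totF' : total_on F' subset.
  move=> X X' [G [h gG]] [G' [h' gG']].
  by have [[]|[]] := cmp _ _ _ _ _ _ gG gG'; [left|right].
have F'sub X : F' X -> subspace X by move=> [G [h [_ gX _]]]; exact: gsub gX.
have sXX : subspace (\bigcup_(X in F') X) /\
    forall a u v, (\bigcup_(X in F') X) u -> (\bigcup_(X in F') X) v ->
      f (a *: u + v) = a *: f u + f v.
  have [X [h gG]] := ex G0 FG0.
  have two u v : (\bigcup_(X in F') X) u -> (\bigcup_(X in F') X) v ->
      exists G X h, [/\ good_graph G X h, X u & X v].
    move=> [A FA Au] [A' FA' Av].
    have [S|S] := totF' A A' FA FA'.
      by have [G [h' gG']] := FA'; exists G, A', h'; split=> //; exact: S.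
    by have [G [h' gG']] := FA; exists G, A, h'; split=> //; exact: S.
  split.
    apply/subspaceP; split.
      exists X; first by exists G0, h.
      have [_ gX _] := gG; by have /subspaceP[] := gsub _ _ gX.
    move=> a u v Uu Uv; have [G [A [h' [gG' Au Av]]]] := two u v Uu Uv.
    exists A; first by exists G, h'.
    by have [_ gA _] := gG'; have /subspaceP[_ AL] := gsub _ _ gA; exact: AL.
  move=> a u v Uu Uv; have [G [A [h' [gG' Au Av]]]] := two u v Uu Uv.
  have [_ gA _] := gG'; have /subspaceP[_ AL] := gsub _ _ gA.
  rewrite (fP _ _ _ _ gG' Au) (fP _ _ _ _ gG' Av).
  by rewrite (fP _ _ _ _ gG' (AL a _ _ Au Av)) linearP.
have [h hP] := linear_extend sXX.1 sXX.2.
have hE G X h' : good_graph G X h' -> forall x, X x -> h x = h' x.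
  move=> gG x Xx; rewrite hP; first exact: fP gG Xx.
  by exists X => //; exists G, h'.
exists (\bigcup_(X in F') X), h; split.
  apply: gchain => // [|X [G [h' gG]]].
    by have [X [h' gG]] := ex G0 FG0; exists X, G0, h'.
  have [_ gX _] := gG; apply: geq gX => x Xx; by rewrite (hE _ _ _ gG).
apply/seteqP; split=> [[x u]|[x u] [/= [X [G [h' gG]] Xx] ->]].
  move=> Gx; have [G [X [h' gG]] gxu] : exists2 G, exists X h', good_graph G X h' &
      (G `|` gr X0 h0) (x, u).
    case: Gx => [[G FG Gx]|gx]; first by exists G; [exact: ex|left].
    by exists G0; [exact: ex|right].
  have [FG gX E] := gG; move: gxu; rewrite E => -[/= Xx ->].
  split=> /=; last by rewrite (hE _ _ _ gG).
  by exists X => //; exists G, h'.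
have [FG gX E] := gG; rewrite (hE _ _ _ gG) //.
have : gr X h' (x, h' x) by [].
by rewrite -E => -[Gx|gx]; [left; exists G|right].
Qed.

(** * Maximal domains of convolution invertible maps *)

Section MaximalInverse.
Variables (k : fieldType) (D : coalgType k) (H : algType k).
Variables (J : Type) (T : J -> D -> D) (S : J -> H -> H).

(** The families [T] and [S] abstract a module structure: an empty index type imposes no condition,
    while the actions of the elements of [B] express stability of the domain and [B]-linearity. *)
Definition equivariant_on (X : set D) (f : {linear D -> H}) : Prop :=
  forall j x, X x -> X (T j x) /\ f (T j x) = S j (f x).

(** Zorn's lemma is applied to [f] and its inverse together, as one map to [H * H], so that the
    union of a chain has an inverse too. A competitor only has to extend [f]: its inverse then
    extends [g] by uniqueness. *)
Lemma maximal_inverse (X0 : set D) (f0 g0 : {linear D -> H}) :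
  subcoalg X0 -> inv_on X0 f0 g0 -> equivariant_on X0 f0 ->
  exists X (f g : {linear D -> H}),
    [/\ [/\ subcoalg X, inv_on X f g & equivariant_on X f],
        X0 `<=` X, forall x, X0 x -> f x = f0 x &
        forall X' (f' g' : {linear D -> H}), subcoalg X' -> inv_on X' f' g' ->
          equivariant_on X' f' -> X `<=` X' -> (forall x, X x -> f' x = f x) ->
          X' `<=` X].
Proof.
move=> cX0 i0 e0.
have fstL : linear (fst : H * H -> H) by [].
have sndL : linear (snd : H * H -> H) by [].
pose p1 (h : {linear D -> (H * H)%type}) : {linear D -> H} := mklin fstL \o h.
pose p2 (h : {linear D -> (H * H)%type}) : {linear D -> H} := mklin sndL \o h.
have pairL (f g : {linear D -> H}) : linear (fun x => (f x, g x)).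
  by move=> a x y; rewrite !linearP.
pose good X h := [/\ subcoalg X, inv_on X (p1 h) (p2 h) & equivariant_on X (p1 h)].
have [X h []||F h [X1 FX1] Ftot gF||X [h [[cX iX eX] X0X h0 hmax]]] :=
  @zorn_linear k D (H * H)%type good X0 (mklin (pairL f0 g0)).
- by move=> [].
- move=> X h h' hh [cX iX eX]; split=> //.
    by apply: inv_on_eq iX => // x Xx; rewrite /= hh.
  move=> j x Xx; have [XT fT] := eX j x Xx; split=> //.
  by move: fT; rewrite /= !hh.
- split.
  + split.
      apply/subspaceP; split.
        by exists X1 => //; have [[/subspaceP[]]] := gF X1 FX1.
      move=> a u v [A FA Au] [B FB Bv]; have [S1|S1] := Ftot A B FA FB.
        exists B => //; have [[/subspaceP[_ L] _] _ _] := gF B FB.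
        by apply: L => //; exact: S1.
      exists A => //; have [[/subspaceP[_ L] _] _ _] := gF A FA.
      by apply: L => //; exact: S1.
    move=> c [A FA Ac]; have [[_ AD] _ _] := gF A FA.
    by have := AD c Ac; apply: tens_setS => x Ax; exists A.
  + by move=> c [A FA Ac]; have [_ iA _] := gF A FA; exact: iA.
  + move=> j c [A FA Ac]; have [_ _ eA] := gF A FA.
    by have [AT fT] := eA j c Ac; split=> //; exists A.
- by split.
exists X, (p1 h), (p2 h); split=> // [x X0x|X' f' g' cX' iX' eX' XX' f'f].
  by rewrite /p1 /= h0.
apply: (hmax _ (mklin (pairL f' g'))) => // x Xx /=.
have g'g : g' x = p2 h x.
  apply: (inverse_unique cX (f := f') _ _ Xx) => c Xc.
    exact: (iX' c (XX' c Xc)).2.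
  by rewrite -[RHS](iX c Xc).1; apply: (conv_local cX).
by rewrite f'f // g'g -surjective_pairing.
Qed.

End MaximalInverse.

(** * The dual algebra acting on a coalgebra, and enlarging a maximal domain *)

Section ExtendInverse.
Variables (k : fieldType) (D : coalgType k).
Implicit Types (X L N : set D) (f g : {linear D -> k^o}).
Local Notation eps := (@counit k D).

(** The left action of the dual algebra on [D], sending [c] to f(c_2) c_1; its stable subspaces are
    the right coideals. *)
Definition hit (f : {linear D -> k^o}) (c : D) : D := hitr f (comult c).

Lemma hit_conv f g c : g (hit f c) = conv g f c.
Proof. exact: hitr_conv. Qed.

Lemma subcoalg_hit X f c : subcoalg X -> X c -> X (hit f c).
Proof. exact: subcoalg_hitr. Qed.

Lemma hit_hit f g c : hit g (hit f c) = hit (conv g f) c.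
Proof. by apply: functional_ext => h; rewrite !hit_conv convA. Qed.

Lemma hit_counit c : hit eps c = c.
Proof. exact: counitr. Qed.

Lemma hit_linear_fun a f g (c : D) :
  hit (a \*: f \+ g) c = a *: hit f c + hit g c.
Proof.
rewrite /hit /hitr /tlift /fsum scaler_sumr -big_split; apply: eq_bigr => p _ /=.
by rewrite scalerDl scalerA.
Qed.

Lemma hitB f g (c : D) : hit (f \- g) c = hit f c - hit g c.
Proof.
rewrite /hit /hitr /tlift /fsum -sumrB; apply: eq_bigr => p _ /=.
by rewrite scalerBl.
Qed.

Lemma hit0 (c : D) : hit (\0 : {linear D -> k^o}) c = 0.
Proof. by apply: tlift_eq0 => x y; rewrite scale0r. Qed.

Lemma hit_linear f : linear (hit f).
Proof.
by move=> a x y; rewrite /hit linearP /hitr (tlift_linear (hitr_bilin D f)).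
Qed.

HB.instance Definition _ f :=
  GRing.isLinear.Build k D D *:%R (hit f) (hit_linear f).

Definition right_coideal L : Prop :=
  subspace L /\ forall f l, L l -> L (hit f l).

(** The orbit of [d] under the dual algebra contains [d] and lies in the span of the left factors of
    a sum for [comult d]. Among such coideals, one inside the span of a shortest list is minimal: a
    proper right subcoideal would lie in the span of a shorter list by [fspan_kernel]. *)
Lemma minimal_right_coideal X d : ~ X d ->
  exists L, [/\ right_coideal L, ~ L `<=` X,
    exists2 s : seq D, (forall x, x \in s -> L x) & forall l, L l -> fspan s l &
    forall N, right_coideal N -> N `<=` L -> ~ N `<=` X -> L `<=` N].
Proof.
move=> nXd.
pose P n := exists L (s : seq D),
  [/\ right_coideal L, ~ L `<=` X, size s = n & forall l, L l -> fspan s l].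
have exP : exists n, `[< P n >].
  pose s := map fst (repr (comult d)).
  exists (size s); apply/asboolP.
  exists [set x | exists f : {linear D -> k^o}, x = hit f d], s; split=> //.
  - split=> [|g _ [f ->]]; last by rewrite hit_hit; exists (conv g f).
    apply/subspaceP; split; first by exists \0; rewrite hit0.
    by move=> a _ _ [f ->] [g ->]; exists (a \*: f \+ g); rewrite hit_linear_fun.
  - by move=> LX; apply/nXd/LX; exists eps; rewrite hit_counit.
  - move=> _ [f ->]; rewrite /hit /hitr /tlift /fsum big_seq.
    have /subspaceP[s0 sL] := fspan_subspace s.
    elim/big_ind: _ => // [u v su sv|p pd]; first by rewrite -[u]scale1r; exact: sL.
    rewrite -[_ *: _]addr0; apply: sL => //; apply: fspan_mem; exact: map_f.
have [n /asboolP[L [s [cL nLX sn Ls]]] nmin] := ex_minnP exP.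
exists L; split=> //; first exact: fspan_generators cL.1 Ls.
move=> N cN NL nNX l Ll; apply: contrapT => nNl.
have [f [fN fl]] := subspace_sep cN.1 nNl.
have [|t ts tP] := fspan_kernel (Ls l Ll) (f := f); first by rewrite fl oner_eq0.
suff /asboolP/nmin : P (size t) by rewrite -sn leqNgt ts.
exists N, t; split=> // x Nx; apply: tP; last exact: fN.
exact/Ls/NL.
Qed.

(* Jacobson density for the simple comodule L + X / X, the ideal of functionals
   vanishing on X acting on it without annihilated vectors as X /\ X = X. *)
Lemma local_unit X L : subcoalg X -> wedge X X `<=` X -> right_coideal L ->
  (forall N, right_coideal N -> N `<=` L -> ~ N `<=` X -> L `<=` N) ->
  forall s : seq D, (forall x, x \in s -> L x) ->
  exists2 e : {linear D -> k^o}, vanish X e & forall x, x \in s -> X (hit e x - x).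
Proof.
move=> cX wX cL Lmin; have [X0 XL] := (subspaceP _).1 cX.1.
have [L0 LL] := (subspaceP _).1 cL.1.
have XB u v : X u -> X v -> X (u - v).
  by move=> Xu Xv; rewrite addrC -scaleN1r; exact: XL.
elim=> [_|l s ih sL]; first by exists \0.
have [|e eX es] := ih; first by move=> x xs; apply: sL; rewrite inE xs orbT.
have Ll : L l by apply: sL; rewrite mem_head.
have [Xv|nXv] := pselect (X (hit e l - l)).
  by exists e => // x; rewrite inE => /predU1P[->|/es].
pose w : {linear D -> k^o} := e \- eps.
have wE x : hit e x - x = hit w x.
  by rewrite /w hitB hit_counit.
(* The possible corrections of [hit e l] by functionals that vanish on [X] and send the elements of
   [s] into [X]. *)
pose N := [set x | exists f : {linear D -> k^o}, [/\ vanish X f,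
  forall y, y \in s -> X (hit f y) & x = hit f l]].
have cN : right_coideal N.
  split=> [|g _ [f [fX fs ->]]].
    apply/subspaceP; split.
      by exists \0; split=> // [y _|]; rewrite hit0.
    move=> a _ _ [f [fX fs ->]] [g [gX gs ->]]; exists (a \*: f \+ g).
    split=> [x Xx|y ys|]; last by rewrite hit_linear_fun.
      by rewrite /= fX // gX // scaler0 addr0.
    by rewrite hit_linear_fun; apply: XL; [exact: fs|exact: gs].
  exists (conv g f); split; last by rewrite hit_hit.
    exact: vanish_convl.
  by move=> y ys; rewrite -hit_hit; apply: subcoalg_hit => //; exact: fs.
have NL : N `<=` L by move=> _ [f [_ _ ->]]; exact: cL.2.
(* If [N] lay in [X], then for [f], [g] vanishing on [X] the element [hit g (hit w l)] of [N] would
   be killed by [f]. This puts [hit w l] in the wedge square, hence in [X], against [nXv]. *)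
have nNX : ~ N `<=` X.
  move=> NX; apply: nXv; apply: wX; apply/(wedgeP _ cX.1 cX.1) => f g fX gX.
  rewrite wE -hit_conv; apply: fX; apply: NX.
  rewrite hit_hit; exists (conv g w); split=> //; first exact: vanish_convr.
  by move=> y ys; rewrite -hit_hit -wE; apply: subcoalg_hit => //; exact: es.
have [|f [fX fs fl]] := Lmin N cN NL nNX (hit e l - l).
  rewrite wE; exact: cL.2.
exists (e \- f) => [x Xx|x]; first by rewrite /= eX // fX // subrr.
rewrite inE hitB addrAC => /predU1P[->|xs]; first by rewrite -fl subrr.
by apply: XB; [exact: es|exact: fs].
Qed.

(** Here [e] acts as the identity modulo [X] on a right coideal [L] not inside [X]. Contracting some
    [l] of [L] by a functional [f0] with [f0 l = 1] that kills [X] gives an element of [T] where [e]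
    takes the value 1, so [T] cannot lie in [X]. *)
Lemma separated_subcoalg X d : subcoalg X -> wedge X X `<=` X -> ~ X d ->
  exists (e : {linear D -> k^o}) T,
    [/\ vanish X e, subcoalg T, forall t, T t -> e t = eps t & ~ T `<=` X].
Proof.
move=> cX wX nXd; have [X0 XL] := (subspaceP _).1 cX.1.
have [L [cL nLX [s sL Ls] Lmin]] := minimal_right_coideal nXd.
have [e eX es] := local_unit cX wX cL Lmin sL.
pose w : {linear D -> k^o} := e \- eps.
have wE x : hit w x = hit e x - x.
  by rewrite /w hitB hit_counit.
have wL l : L l -> X (hit w l).
  move=> /Ls; apply: (fspan_sub (X := [set l | X (hit w l)])).
    apply/subspaceP; split; first by rewrite /= linear0.
    by move=> a u v Xu Xv; rewrite /= hit_linear; exact: XL.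
  by move=> x /es; rewrite -wE.
(* The annihilator of the two-sided ideal generated by [w], hence a subcoalgebra; [w] itself
   vanishes on it, so [e] equals the counit there. *)
pose T := [set t | forall f g : {linear D -> k^o}, conv (conv f w) g t = 0].
have eT t : T t -> e t = eps t.
  move=> /(_ (conv1 k^o) (conv1 k^o)); rewrite convf1 /= conv1f.
  exact: subr0_eq.
exists e, T; split=> //.
  apply: subcoalgI => [|h t Tt f g|h t Tt f g].
  - apply/subspaceP; split=> [f g|a u v Tu Tv f g]; first by rewrite linear0.
    by rewrite (linearP (conv (conv f w) g)) /= Tu Tv scaler0 addr0.
  - by rewrite hit_conv -convA; exact: Tt.
  - rewrite hitl_conv convA -[RHS](Tt (conv h f) g).
    by apply: conv_eq => // x; exact: convA.
move=> TX; apply: nLX => l Ll; apply: contrapT => nXl.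
have [f0 [f0X f0l]] := subspace_sep cX.1 nXl.
have Tl : T (hitl f0 (comult l)).
  move=> f g; rewrite hitl_conv convA -hit_conv.
  transitivity (conv (conv f0 f) w (hit g l)); first exact: convA.
  rewrite -hit_conv; apply: (vanish_convr f cX f0X); apply: wL.
  exact: cL.2.
have /eqP := eT _ Tl; rewrite eX; last exact: TX.
rewrite hitl_conv (_ : conv f0 eps l = f0 l) ?f0l ?(eq_sym 0) ?oner_eq0 //.
by rewrite -hit_conv hit_counit.
Qed.

Lemma extend_inverse (H : algType k) (E : set D) (f0 g0 : {linear D -> H}) :
  subcoalg E -> inv_on E f0 g0 ->
  exists f g : {linear D -> H},
    inv_on setT f g /\ forall x, E x -> f x = f0 x.
Proof.
move=> cE iE; pose TJ (j : void) (x : D) := x; pose SJ (j : void) (x : H) := x.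
have [//|X [f [g [[cX iX _] EX ff0 Xmax]]]] :=
  @maximal_inverse k D H void TJ SJ E f0 g0 cE iE.
have [XT|/existsNP[d nXd]] := pselect (forall d, X d).
  by exists f, g; split=> // c _; exact: iX.
have wX : wedge X X `<=` X.
  have [g' iW] := wedge_inv cX iX; have cW := wedge_subcoalg cX cX.
  apply: (Xmax _ f g') => //; exact: (sub_wedge cX cX.1).
have [e [T [eX cT eT nTX]]] := separated_subcoalg cX wX nXd.
case: nTX; pose Z (b : bool) := if b then X else T.
have cZ : subcoalg (addspan (\bigcup_b Z b)) by apply: subcoalg_addspan => -[].
have eL : linear (fun x => (e x : k) *: (1 : H)).
  by move=> a x y; rewrite linearP scalerDl scalerA.
pose eH := mklin eL.
pose eC : {linear D -> H} := conv1 H \- eH.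
pose glue (h : {linear D -> H}) : {linear D -> H} := conv h eC \+ eH.
have glueX h x : X x -> glue h x = h x.
  move=> Xx; rewrite /glue /= eX // scale0r addr0 -[RHS]convf1.
  apply: (conv_local (f := h) (f' := h) (g := eC) (g' := conv1 H) cX) => // y Xy.
  by rewrite /eC /= eX // scale0r subr0.
have glueT h x : T x -> glue h x = conv1 H x.
  move=> Tx; rewrite /glue /= eT // -[RHS]add0r; congr (_ + _).
  apply: (tlift_local0 (conv_bilin h eC) _ (cT.2 _ Tx)) => u v _ Tv.
  by rewrite /eC /= eT // subrr mulr0.
have TZ : T `<=` addspan (\bigcup_b Z b).
  by move=> x Tx; apply: addspan_mem; exists false.
have XZ : X `<=` addspan (\bigcup_b Z b).
  by move=> x Tx; apply: addspan_mem; exists true.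
apply: subset_trans TZ _; apply: (Xmax _ (glue f) (glue g)) => //; last first.
  by move=> x Xx; exact: glueX.
(* Invertibility is a linear condition on [c], so it can be checked on [X] and on [T] separately. *)
pose K := [set c | conv (glue f) (glue g) c = conv1 H c /\
                   conv (glue g) (glue f) c = conv1 H c].
apply: (addspan_min (X := K)).
  apply/subspaceP; split=> [|a u v [fu gu] [fv gv]].
    by split; rewrite !linear0.
  by split; rewrite linearP [RHS]linearP; congr (_ *: _ + _).
have iGX : inv_on X (glue f) (glue g).
  by apply: inv_on_eq iX => // x Xx; rewrite glueX.
have iGT : inv_on T (glue f) (glue g).
  apply: (inv_on_eq cT (f := conv1 H) (g := conv1 H)) => [x Tx|x Tx|x _].
  - by rewrite glueT.
  - by rewrite glueT.
  - by rewrite !convf1.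
by move=> c [[] _ /= Zc]; [exact: iGX|exact: iGT].
Qed.

End ExtendInverse.

(** * Module coalgebras *)

Section ModuleCoalgebra.
Variables (k : fieldType) (B : bialgType k) (C : modCoalgType B).
Implicit Types (X : set C) (f g : {linear C -> B}).

Lemma tlift_tmap2 (V W X V' W' X' U : lmodType k) (f : V -> W -> X)
    (g : V' -> W' -> X') (F : X -> X' -> U) s t :
  bilin f -> bilin g -> bilin F ->
  tlift F (tmap2 f g s t) =
  tlift (fun x y => tlift (fun u v => F (f x u) (g y v)) t) s.
Proof.
move=> bf bg bF; have bfg := tmap2_bilin bf bg.
have b1 x y : bilin (fun u v => F (f x u) (g y v)).
  by split=> [v a u u'|u a v v']; rewrite ?bf.2 ?bg.2 ?bF.1 ?bF.2.
have b2 : bilin (fun x y => tlift (fun u v => F (f x u) (g y v)) t).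
  split=> [y|x]; apply: tlift_param => u v a z z'.
    by rewrite bf.1 bF.1.
  by rewrite bg.1 bF.2.
move: s; apply: tensor_ext => [a s s'|a s s'|x y].
- by rewrite bfg.1 (tlift_linear bF).
- by rewrite (tlift_linear b2).
rewrite (tliftE _ _ b2); move: t {b2}; apply: tensor_ext => [a t t'|a t t'|u v].
- by rewrite bfg.2 (tlift_linear bF).
- by rewrite (tlift_linear (b1 x y)).
- by rewrite (tliftE _ _ (b1 x y)) (tmap2E _ _ _ _ bf bg) (tliftE _ _ bF).
Qed.

Lemma bilin_act2 (U : lmodType k) (F : C -> C -> U) t : bilin F ->
  bilin (fun x y => tlift (fun u v : B => F (act x u) (act y v)) t).
Proof.
move=> bF; split=> [y|x]; apply: tlift_param => u v a z z'.
  by rewrite act_bilin.1 bF.1.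
by rewrite act_bilin.1 bF.2.
Qed.

Lemma tlift_comult_act (U : lmodType k) (F : C -> C -> U) c b : bilin F ->
  tlift F (comult (act c b)) =
  tlift (fun x y => tlift (fun u v => F (act x u) (act y v)) (comult b))
    (comult c).
Proof.
by move=> bF; rewrite comult_act tlift_tmap2 //; exact: act_bilin.
Qed.

Lemma submodule_subcoalg X : submodule_coalgebra X -> subcoalg X.
Proof. by case. Qed.

Definition module_on X f : Prop := forall c b, X c -> f (act c b) = f c * b.

Definition trivial_on X f : Prop :=
  forall c b, X c -> f (act c b) = (counit b : k) *: f c.

Definition cocleft_on X f g : Prop := module_on X f /\ inv_on X f g.

(** The Sweedler sum b_1 g(c b_2). By [twistE] it equals eps(b) g(c) when [g] inverts a module map;
    over a Hopf algebra this is the rule g(c b) = S(b) g(c) in antipode-free form. *)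
Definition twist g (b : B) (c : C) : B :=
  tlift (fun u v => u * g (act c v)) (comult b).

Fact twist_linear g b : linear (twist g b).
Proof.
apply: tlift_param => u v a x y.
by rewrite act_bilin.1 linearP mulrDr scalerAr.
Qed.

HB.instance Definition _ g b :=
  GRing.isLinear.Build k C B *:%R (twist g b) (twist_linear g b).

Lemma conv_act X f g c b : submodule_coalgebra X -> module_on X f -> X c ->
  conv f g (act c b) = conv f (twist g b) c.
Proof.
move=> hX mf Xc; have bfg := conv_bilin f g.
rewrite /conv tlift_comult_act //; have [_ XD _] := hX.
apply: (tlift_local (bilin_act2 _ bfg) (conv_bilin f (twist g b)) _ (XD c Xc)).
move=> x y Xx _; pose m := mklin ((bilin_mul B).2 (f x)).
rewrite [RHS](linear_tlift m); apply: tlift_eq => u v.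
by rewrite mf // /= mulrA.
Qed.

(* Convolving f * (twist g b) = eps(b) (f * g) with g on the left. *)
Lemma twistE X f g c b : submodule_coalgebra X -> cocleft_on X f g -> X c ->
  twist g b c = (counit b : k) *: g c.
Proof.
move=> hX [mf ig] Xc; have cX := submodule_subcoalg hX; have [_ _ XB] := hX.
pose e1 : {linear C -> B} := (counit b : k) \*: conv1 B.
have ft x : X x -> conv f (twist g b) x = e1 x.
  move=> Xx; rewrite -(conv_act _ _ hX mf Xx) (ig _ (XB _ b Xx)).1.
  by rewrite /e1 /= /conv1 counit_act scalerA mulrC.
rewrite -[LHS]conv1f.
rewrite -(conv_local (f := conv g f) (g := twist g b) cX _ _ Xc) //; last first.
  by move=> x Xx; exact: (ig x Xx).2.
rewrite -convA (conv_local (f := g) (g := conv f (twist g b))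
  (f' := g) (g' := e1) cX _ _ Xc) //.
by rewrite -(convf1 g) -convZr.
Qed.

Lemma conv_trivial X f g : submodule_coalgebra X -> module_on X f ->
  (forall c b, X c -> twist g b c = (counit b : k) *: g c) ->
  trivial_on X (conv f g).
Proof.
move=> hX mf tg c b Xc; rewrite [LHS](conv_act _ _ hX mf Xc) -[RHS]convZr.
pose g1 : {linear C -> B} := (counit b : k) \*: g.
apply: (conv_local (f := f) (g := twist g b) (f' := f) (g' := g1) _ _ _ Xc) => //.
  exact: submodule_subcoalg.
by move=> x Xx; exact: tg.
Qed.

Lemma conv_trivial_module X f g : submodule_coalgebra X -> trivial_on X f ->
  module_on X g -> module_on X (conv f g).
Proof.
move=> hX tf mg c b Xc; have bfg := conv_bilin f g; have [_ XD _] := hX.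
pose m := mklin ((bilin_mul B).1 b); have bm := bilin_comp m f g (bilin_mul B).
rewrite [RHS](linear_tlift m) [LHS]tlift_comult_act //.
apply: (tlift_local (bilin_act2 _ bfg) bm _ (XD c Xc)) => x y Xx Xy.
pose l := mklin ((bilin_mul B).2 (f x * g y)).
rewrite -[RHS]/(l b) -[in RHS](counitl b) linear_tlift.
apply: tlift_eq => u v; rewrite tf // mg // linearZ_LR /=.
by rewrite -scalerAl mulrA.
Qed.

Lemma conv_trivial2 X f g : submodule_coalgebra X -> trivial_on X f ->
  trivial_on X g -> trivial_on X (conv f g).
Proof.
move=> hX tf tg c b Xc; have bfg := conv_bilin f g; have [_ XD _] := hX.
pose m : {linear B -> B} := (counit b : k) \*: idfun.
have bm := bilin_comp m f g (bilin_mul B).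
rewrite -[RHS]/(m _) [RHS](linear_tlift m) [LHS]tlift_comult_act //.
apply: (tlift_local (bilin_act2 _ bfg) bm _ (XD c Xc)) => x y Xx Xy.
have lL : linear (fun a : B => (counit a : k) *: (f x * g y)).
  by move=> a u v; rewrite (linearP (@counit k B)) scalerDl scalerA.
pose l := mklin lL.
rewrite -[RHS]/(l b) -[in RHS](counitl b) linear_tlift.
apply: tlift_eq => u v; rewrite tf // tg // linearZ_LR /=.
by rewrite -scalerAl -scalerAr.
Qed.

Definition eps_of f (c : C) : B := (counit (f c) : k) *: 1.

Fact eps_of_linear f : linear (eps_of f).
Proof. by move=> a x y; rewrite /eps_of !linearP scalerDl scalerA. Qed.

HB.instance Definition _ f :=
  GRing.isLinear.Build k C B *:%R (eps_of f) (eps_of_linear f).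

(** The counit of [B] is an algebra map, so composing with it preserves convolution products and
    hence inverses. *)
Lemma conv_eps_of f g c :
  conv (eps_of f) (eps_of g) c = (counit (conv f g c) : k) *: 1.
Proof.
have lL : linear (fun a : B => (counit a : k) *: (1 : B)).
  by move=> a u v; rewrite (linearP (@counit k B)) scalerDl scalerA.
rewrite [RHS](linear_tlift (mklin lL)); apply: tlift_eq => x y.
by rewrite /= /eps_of counitM -scalerAl mul1r scalerA.
Qed.

Lemma eps_of_trivial X f : module_on X f -> trivial_on X (eps_of f).
Proof. by move=> mf c b Xc; rewrite /= /eps_of mf // counitM scalerA mulrC. Qed.

(** The Sweedler sum c_1 g(c_2). When [g] inverts a cointegral, it sends c b to eps(b) times the
    image of c, as does the projection of a Hopf module to its coinvariants. *)
Definition coinv g (c : C) : C := tlift (fun x y => act x (g y)) (comult c).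

Lemma coinv_bilin g : bilin (fun x y => act x (g y) : C).
Proof. exact: (bilin_comp idfun idfun g (@act_bilin k B C)). Qed.

Fact coinv_linear g : linear (coinv g).
Proof. by move=> a x y; rewrite /coinv linearP (tlift_linear (coinv_bilin g)). Qed.

HB.instance Definition _ g :=
  GRing.isLinear.Build k C C *:%R (coinv g) (coinv_linear g).

Lemma coinv_act g c b :
  coinv g (act c b) = tlift (fun x y => act x (twist g b y)) (comult c).
Proof.
rewrite /coinv (tlift_comult_act _ _ (coinv_bilin g)).
apply: tlift_eq => x y; pose m := mklin ((@act_bilin k B C).2 x).
rewrite [RHS](linear_tlift m); apply: tlift_eq => u v.
by rewrite actA.
Qed.

Lemma setT_submodule_coalgebra : submodule_coalgebra [set: C].
Proof.
split=> // [|c _]; first exact/subspaceP.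
have sT : subspace [set: C] by exact/subspaceP.
exact: (tens_setI sT sT (tens_set_hitr sT _) (tens_set_hitl sT _)).
Qed.

(* phi o coinv g is trivial everywhere and equals phi * eps(g) on E; the factor
   eps(f) undoes the second one. *)
Lemma extend_trivial E f g phi : submodule_coalgebra E ->
  cocleft_on setT f g -> trivial_on E phi ->
  exists psi : {linear C -> B}, trivial_on setT psi /\ forall x, E x -> psi x = phi x.
Proof.
move=> hE [mf ig] tphi; have hT := setT_submodule_coalgebra.
have cE := submodule_subcoalg hE.
pose theta : {linear C -> B} := phi \o coinv g.
exists (conv theta (eps_of f)); split.
  apply: conv_trivial2 => //; last exact: eps_of_trivial.
  move=> c b _; rewrite /theta /= coinv_act -linearZ_LR; congr (phi _).
  pose m : {linear C -> C} := (counit b : k) \*: idfun.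
  rewrite [RHS](linear_tlift m); apply: tlift_eq => x y.
  rewrite (twistE b hT (conj mf ig)) //=.
  exact: (bilinZr (@act_bilin k B C)).
have thetaE x : E x -> theta x = conv phi (eps_of g) x.
  move=> Ex; rewrite /theta /= linear_tlift.
  have [_ ED _] := hE; apply: (tlift_local _ (conv_bilin phi (eps_of g)) _ (ED x Ex)).
    exact: (bilin_comp phi idfun g (@act_bilin k B C)).
  by move=> u v Eu _; rewrite tphi // /eps_of -scalerAr mulr1.
move=> x Ex; transitivity (conv (conv phi (eps_of g)) (eps_of f) x).
  exact: (conv_local (f := theta) (g := eps_of f)
    (f' := conv phi (eps_of g)) (g' := eps_of f) cE).
rewrite -convA -[RHS]convf1; apply: tlift_eq => u v; congr (_ * _).
rewrite /= conv_eps_of (ig v I).2 /conv1 linearZ_LR /= counit1.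
by congr (_ *: _); exact: mulr1.
Qed.

End ModuleCoalgebra.

(** * Quotient coalgebras *)

Section SubLmodule.
Variables (k : fieldType) (V : lmodType k) (X : set V) (sX : subspace X).

(* [sX] is a phantom argument, which lets HB infer closedness from the predicate. *)
Definition subl_pred : {pred V} := let _ := sX in fun x => x \in X.

Fact subl_pred_closed : subsemimod_closed subl_pred.
Proof. by have [X0 XL] := sX; apply: GRing.submod_closed_semi; split. Qed.

HB.instance Definition _ :=
  GRing.isSubmodClosed.Build k V subl_pred subl_pred_closed.

Definition subl : Type := {x : V | subl_pred x}.

HB.instance Definition _ := SubChoice.on subl.
HB.instance Definition _ := [SubChoice_isSubLmodule of subl by <:].

End SubLmodule.

(** The quotient is realised as the kernel of a retraction [r] onto [K], with [s] the inclusion and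
    [p] induced by [idfun - r]. *)
Lemma quotient_lmodule (k : fieldType) (V : lmodType k) (K : set V) :
  subspace K -> exists (D : lmodType k) (p : {linear V -> D}) (s : {linear D -> V}),
    (forall d, p (s d) = d) /\ (forall v, p v = 0 <-> K v).
Proof.
move=> sK; have [r [rK rid]] := subspace_retraction sK.
pose q : {linear V -> V} := idfun \- r.
have sQ : subspace [set v | r v = 0].
  by apply/subspaceP; split=> [|a u v ru rv] /=; rewrite ?linear0 // linearP ru rv
    scaler0 addr0.
have qQ v : [set v | r v = 0] (q v) by rewrite /q /= linearB (rid (r v)) ?subrr.
pose p' (v : V) : subl sQ := Sub (q v) (mem_set (qQ v)).
have p'L : linear p' by move=> a u v; apply: val_inj; exact: (linearP q).
exists (subl sQ), (mklin p'L), \val; split=> [d|v].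
  apply: val_inj; rewrite /= /q /=.
  by have /set_mem /= -> := valP d; rewrite subr0.
split=> [/(congr1 val) /= /subr0_eq ->|Kv]; first exact: rK.
by apply: val_inj; rewrite /= rid // subrr.
Qed.

Section QuotientCoalgebra.
Variables (k : fieldType).

Lemma tmap_comp (V W V' W' V'' W'' : lmodType k) (f : {linear V -> V'})
    (g : {linear W -> W'}) (f' : {linear V' -> V''}) (g' : {linear W' -> W''}) t :
  tmap f' g' (tmap f g t) = tmap (f' \o f) (g' \o g) t.
Proof. exact: (tlift_tmap f g t (tmap_bilin f' g')). Qed.

Lemma tassoc_tmap (U V W U' V' W' : lmodType k) (f : {linear U -> U'})
    (g : {linear V -> V'}) (h : {linear W -> W'}) t :
  tassoc (tmap (tmap f g) h t) = tmap f (tmap g h) (tassoc t).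
Proof.
pose fg : {linear (U ⊗ V)%type -> (U' ⊗ V')%type} := tmap f g.
pose gh : {linear (V ⊗ W)%type -> (V' ⊗ W')%type} := tmap g h.
move: t; apply: (tensor_ext (linearP (@tassoc k U' V' W' \o tmap fg h))
  (linearP (tmap f gh \o @tassoc k U V W))) => s w /=.
rewrite (tmapE fg h); move: s.
apply: tensor_ext => [a s t|a s t|u v].
- by rewrite linearP (tens_bilin _ _).1 linearP.
- by rewrite (tens_bilin _ _).1 !linearP.
rewrite tassocE (tmapE f gh) /fg /gh /= (tmapE f g) (tmapE g h).
exact: tassocE.
Qed.

(** The coideal condition is phrased through maps [p] killing [K], which avoids describing K ⊗ Y + Y
    ⊗ K. The structure maps are taken along the section [s], and are compatible with [p] because s
    (p y) - y lies in [K]. *)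
Lemma quotient_coalgebra (Y : coalgType k) (K : set Y) : subspace K ->
  (forall (D : lmodType k) (p : {linear Y -> D}), (forall x, K x -> p x = 0) ->
    forall x, K x -> tmap p p (comult x) = 0) ->
  (forall x, K x -> counit x = 0) ->
  exists (D : coalgType k) (p : {linear Y -> D}),
    [/\ forall d, exists y, p y = d, forall x, p x = 0 <-> K x,
        forall y, comult (p y) = tmap p p (comult y) &
        forall y, counit (p y) = counit y].
Proof.
move=> sK KD Ke.
(* Destructed because [HB.pack] rebuilds the module structure from its fields,
   and the result is convertible to D only if D is a constructor. *)
have [[T [m1 m2 m3 m4 m5 m6 m7 m8 m9 m10]] [p [s [ps pK]]]] := quotient_lmodule sK.
set D := GRing.Lmodule.Pack _ in p s ps pK.
pose pp : {linear (Y ⊗ Y)%type -> (D ⊗ D)%type} := tmap p p.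
pose dD : {linear D -> (D ⊗ D)%type} := pp \o (@comult k Y \o s).
pose eD : {linear D -> k^o} := @counit k Y \o s.
have sp y : K (s (p y) - y) by apply/pK; rewrite linearB ps subrr.
have dE y : dD (p y) = pp (comult y).
  apply: subr0_eq; rewrite /dD /= -!linearB.
  by apply: KD => // x /pK.
have eE y : eD (p y) = counit y by apply: subr0_eq; rewrite /eD /= -linearB Ke.
have ex d : exists y, p y = d by exists (s d).
have dA d : tassoc (tmap dD idfun (dD d)) = tmap idfun dD (dD d).
  have [y <-] := ex d; rewrite dE /pp /= !tmap_comp.
  transitivity (tassoc (tmap pp p (tmap comult idfun (comult y)))).
    rewrite tmap_comp; congr tassoc; apply: tlift_eq => u v.
    by congr (_ ⊗ _); exact: dE.
  rewrite [LHS]tassoc_tmap comultA [LHS](tmap_comp idfun comult p pp).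
  by apply: tlift_eq => u v; congr (_ ⊗ _); exact/esym/dE.
have eL d : tlift (fun x y => eD x *: y) (dD d) = d.
  have [y <-] := ex d; rewrite dE (tlift_tmap p p _ (hitl_bilin D eD)).
  rewrite -[in RHS](counitl y) linear_tlift; apply: tlift_eq => u v.
  by rewrite eE linearZ_LR.
have eR d : tlift (fun x y => eD y *: x) (dD d) = d.
  have [y <-] := ex d; rewrite dE (tlift_tmap p p _ (hitr_bilin D eD)).
  rewrite -[in RHS](counitr y) linear_tlift; apply: tlift_eq => u v.
  by rewrite eE linearZ_LR.
pose DC : coalgType k := HB.pack T (GRing.Lmodule.class D)
  (Lmodule_isCoalgebra.Build k D dA eL eR).
by exists DC, p; split.
Qed.

End QuotientCoalgebra.

(** * Cointegrals *)

Section CocleftExtension.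
Variables (k : fieldType) (B : bialgType k).

(** The quotient is Y / Y B^+. It is a coalgebra because p(y b) = eps(b) p(y) turns p(y_1 b_1) ⊗
    p(y_2 b_2) into eps(b) p(y_1) ⊗ p(y_2). *)
Lemma trivial_quotient (Y : modCoalgType B) :
  exists (D : coalgType k) (p : {linear Y -> D}),
    [/\ forall d, exists y, p y = d,
        forall y, comult (p y) = tmap p p (comult y),
        forall y, counit (p y) = counit y,
        forall y b, p (act y b) = (counit b : k) *: p y &
        forall f : {linear Y -> B}, trivial_on setT f ->
          exists f' : {linear D -> B}, forall y, f' (p y) = f y].
Proof.
pose K0 := [set x : Y | exists y b, x = act y b - (counit b : k) *: y].
have ab := @act_bilin k B Y.
have sK : subspace (addspan K0).
  apply: addspan_subspace => a _ [y [b ->]]; exists (a *: y), b.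
  by rewrite (bilinZl ab) scalerBr !scalerA mulrC.
have K0K x : K0 x -> addspan K0 x by exact: addspan_mem.
have s0 (V W : lmodType k) (h : {linear V -> W}) : subspace [set v | h v = 0].
  by apply/subspaceP; split=> [|a u v hu hv] /=;
     rewrite ?linear0 // linearP hu hv scaler0 addr0.
have [||D [p [ps pK pD pe]]] := quotient_coalgebra sK.
- move=> D p pK; pose pp : {linear (Y ⊗ Y)%type -> (D ⊗ D)%type} := tmap p p.
  pose h : {linear Y -> (D ⊗ D)%type} := pp \o @comult k Y.
  apply: (addspan_min (s0 _ _ h)) => _ [y [b ->]].
  have pb x c : p (act x c) = (counit c : k) *: p x.
    by apply: subr0_eq; rewrite -linearZ_LR -linearB pK //; apply: K0K; exists x, c.
  suff E : h (act y b) = (counit b : k) *: h y.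
    transitivity (h (act y b) - (counit b : k) *: h y); last by rewrite E subrr.
    by rewrite -linearZ_LR -linearB.
  have bpp := bilin_comp idfun p p (tens_bilin D D).
  rewrite [LHS](tlift_comult_act _ _ bpp).
  pose m : {linear (D ⊗ D)%type -> (D ⊗ D)%type} := (counit b : k) \*: idfun.
  rewrite -[RHS]/(m _) [RHS](linear_tlift m); apply: tlift_eq => u v.
  have lL : linear (fun c : B => (counit c : k) *: (p u ⊗ p v)).
    by move=> a c c'; rewrite (linearP (@counit k B)) scalerDl scalerA.
  rewrite -[RHS]/(mklin lL b) -[in RHS](counitl b) linear_tlift.
  apply: tlift_eq => c c' /=; rewrite !pb linearZ_LR /=.
  rewrite (bilinZl (tens_bilin D D)) (bilinZr (tens_bilin D D)).
  exact: scalerA.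
- apply: (addspan_min (s0 _ _ (@counit k Y))) => _ [y [b ->]].
  by rewrite /= linearB linearZ_LR counit_act [_ *: _]mulrC subrr.
exists D, p; split=> // [y b|f tf].
  apply: subr0_eq; rewrite -linearZ_LR -linearB; apply/pK; apply: K0K.
  by exists y, b.
apply: lin_factor => v /pK.
apply: (addspan_min (s0 _ _ f)) => _ [y [b ->]].
by rewrite /= linearB linearZ_LR tf // subrr.
Qed.

Lemma inv_on_conv (C : coalgType k) X (f f' g g' : {linear C -> B}) :
  subcoalg X -> inv_on X f f' -> inv_on X g g' ->
  inv_on X (conv f g) (conv g' f').
Proof.
have half (a a' b b' : {linear C -> B}) c : subcoalg X ->
    (forall x, X x -> conv b b' x = conv1 B x) ->
    (forall x, X x -> conv a a' x = conv1 B x) -> X c ->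
    conv (conv a b) (conv b' a') c = conv1 B c.
  move=> cX bb aa Xc; rewrite -convA -[RHS]aa //.
  apply: (conv_local (f := a) (g := conv b (conv b' a')) cX _ _ Xc) => // x Xx.
  rewrite /= convA -[RHS]conv1f.
  exact: (conv_local (f := conv b b') (f' := conv1 B) cX).
move=> cX fi gi c Xc; split; apply: half => // x Xx.
- exact: (gi x Xx).1.
- exact: (fi x Xx).1.
- exact: (fi x Xx).2.
- exact: (gi x Xx).2.
Qed.

Lemma sub_inv_on (C : coalgType k) X Z (f g : {linear C -> B}) :
  X `<=` Z -> inv_on Z f g -> inv_on X f g.
Proof. by move=> XZ i c Xc; apply: i; exact: XZ. Qed.

Lemma cocleft_on_sub (C : modCoalgType B) (X Z : set C) (f g : {linear C -> B}) :
  X `<=` Z -> cocleft_on Z f g -> cocleft_on X f g.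
Proof.
move=> XZ [mf ig]; split; last exact: sub_inv_on ig.
by move=> c b Xc; apply: mf; exact: XZ.
Qed.

Lemma submodule_coalgebraP (C : modCoalgType B) (X : set C) :
  submodule_coalgebra X <-> subcoalg X /\ forall c b, X c -> X (act c b).
Proof. by split=> [[sX XD XB]|[[sX XD] XB]]. Qed.

Lemma inv_onC (C : coalgType k) X (f g : {linear C -> B}) :
  inv_on X f g -> inv_on X g f.
Proof. by move=> i c Xc; have [] := i c Xc. Qed.

(* phi = f0 * g is trivial on E, hence comes from an invertible map on a
   subcoalgebra of Y / Y B^+; extend it there and multiply by f again. *)
Lemma extend_cocleft (Y : modCoalgType B) (E : set Y) (f0 g0 f g : {linear Y -> B}) :
  submodule_coalgebra E -> cocleft_on E f0 g0 -> cocleft_on setT f g ->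
  exists f1 g1 : {linear Y -> B}, cocleft_on setT f1 g1 /\
    forall x, E x -> f1 x = f0 x.
Proof.
move=> hE [m0 i0] [m i]; have hT := setT_submodule_coalgebra Y.
have cE := submodule_subcoalg hE; have cT := submodule_subcoalg hT.
have iE : inv_on E f g by exact: sub_inv_on i.
have mE : module_on E f by move=> c b _; exact: m.
have tphi : trivial_on E (conv f0 g).
  by apply: conv_trivial => // c b; exact: twistE (conj mE iE).
(* The convolution inverse f * g0 has to be trivial as well, so that it also descends to Y / Y
   B^+. *)
have tpsi : trivial_on E (conv f g0).
  by apply: conv_trivial => // c b; exact: twistE (conj m0 i0).
have iphi : inv_on E (conv f0 g) (conv f g0).
  by apply: inv_on_conv => //; exact: inv_onC.
have [phi [tphi' phiE]] := extend_trivial hE (conj m i) tphi.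
have [psi [tpsi' psiE]] := extend_trivial hE (conj m i) tpsi.
have [D [p [ps pD pe pact plift]]] := trivial_quotient Y.
have [[phi' phi'E] [psi' psi'E]] := (plift _ tphi', plift _ tpsi').
have convp (a b : {linear D -> B}) y : conv a b (p y) = conv (a \o p) (b \o p) y.
  by rewrite /conv pD (tlift_tmap p p _ (conv_bilin a b)).
have conv1p y : conv1 B (p y) = conv1 B y by rewrite /conv1 pe.
have iphi' : inv_on E phi psi.
  by apply: inv_on_eq iphi => // x Ex; rewrite ?phiE ?psiE.
have [E0 EL] := (subspaceP _).1 cE.1; have ED := cE.2.
have cpE : subcoalg (p @` E).
  split=> [|_ [y Ey <-]].
    apply/subspaceP; split; first by exists 0; rewrite ?linear0.
    move=> a _ _ [y Ey <-] [z Ez <-]; exists (a *: y + z); last exact: linearP.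
    exact: EL.
  rewrite pD; have [s sE ->] := ED y Ey.
  have -> : tmap p p (\sum_(t <- s) t) = \sum_(t <- s) tmap p p t.
    exact: (linear_sum (tmap p p)).
  exists [seq tmap p p t | t <- s]; last by rewrite big_map.
  move=> _ /mapP[t /sE[x Ex [z Ez <-]] ->]; rewrite (tmapE p p).
  by exists (p x); [exists x|exists (p z) => //; exists z].
have ipE : inv_on (p @` E) phi' psi'.
  move=> _ [y Ey <-]; rewrite !convp conv1p -!(iphi' y Ey).1.
  split; first by apply: conv_eq => x; rewrite /= ?phi'E ?psi'E.
  rewrite (iphi' y Ey).1 -(iphi' y Ey).2.
  by apply: conv_eq => x; rewrite /= ?phi'E ?psi'E.
have [F [G [iFG FE]]] := extend_inverse cpE ipE.
pose Fp : {linear Y -> B} := F \o p; pose Gp : {linear Y -> B} := G \o p.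
have ip : inv_on setT Fp Gp.
  by move=> c _; rewrite -!convp -conv1p; exact: iFG.
have tF : trivial_on setT Fp by move=> c b _; rewrite /Fp /= pact linearZ_LR.
exists (conv Fp f), (conv g Gp); split.
  split; first exact: conv_trivial_module.
  exact: inv_on_conv.
move=> x Ex; transitivity (conv (conv f0 g) f x).
  apply: (conv_local (f := Fp) (f' := conv f0 g) cE) => // y Ey.
  by rewrite /Fp /= FE ?phi'E ?phiE //; exists y.
rewrite -convA -[RHS]convf1.
apply: (conv_local (f := f0) (g := conv g f) (g' := conv1 B) cE) => // y Ey.
exact: (iE y Ey).2.
Qed.

End CocleftExtension.

(** * Transfer between a submodule coalgebra and its ambient coalgebra; sums *)

Section SubmoduleTransfer.
Variables (k : fieldType) (B : bialgType k) (C : modCoalgType B).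
Implicit Types (X Z : set C) (f g : {linear C -> B}).

Definition incl X (hX : submodule_coalgebra X) : {linear subc hX -> C} := \val.

Lemma conv_subc X (hX : submodule_coalgebra X) (H : algType k)
    (f g : {linear C -> H}) (x : subc hX) :
  conv f g (val x) = conv (f \o incl hX) (g \o incl hX) x.
Proof.
rewrite /conv -(subc_comultE x).
exact: (tlift_tmap (incl hX) (incl hX) _ (conv_bilin f g)).
Qed.

Lemma cocleft_on_incl X (hX : submodule_coalgebra X) Z f g : cocleft_on Z f g ->
  cocleft_on [set y : subc hX | Z (val y)] (f \o incl hX) (g \o incl hX).
Proof.
move=> [mf ig]; split=> [y b Zy|y Zy].
  by rewrite /= -mf //; congr (f _); exact: subc_actE.
have [fg gf] := ig _ Zy.
by split; [rewrite -[RHS]fg conv_subc|rewrite -[RHS]gf conv_subc].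
Qed.

Lemma cocleft_on_proj X (hX : submodule_coalgebra X) (f g : {linear subc hX -> B}) :
  cocleft_on setT f g -> cocleft_on X (f \o subc_proj hX) (g \o subc_proj hX).
Proof.
move=> [mf ig]; set p := subc_proj hX.
have pK (h : {linear subc hX -> B}) : (h \o p) \o incl hX =1 h.
  by move=> x; rewrite /= /p subc_projK.
split=> [c b Xc|c Xc]; rewrite -(subc_projE hX Xc); set x := subc_proj hX c.
  by rewrite -subc_actE /p /= !subc_projK; exact: mf.
have [fg gf] := ig x I; split; rewrite conv_subc.
  by rewrite -[RHS]fg; apply: conv_eq; exact: pK.
by rewrite -[RHS]gf; apply: conv_eq; exact: pK.
Qed.

Lemma cocleft_subcP X (hX : submodule_coalgebra X) :
  cocleft (submodcoalg hX) <-> exists f g, cocleft_on X f g.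
Proof.
split=> [[f [mf [g ig]]]|[f [g /(cocleft_on_incl hX)[mf ig]]]].
  exists (f \o subc_proj hX), (g \o subc_proj hX).
  by apply: cocleft_on_proj; split=> [c b _|c _]; [exact: mf|exact: ig].
exists (f \o incl hX); split=> [x b|]; first by apply: mf; exact: subcP.
by exists (g \o incl hX) => x; apply: ig; exact: subcP.
Qed.

(** A contraction in [subc hX] by [h] is the contraction in [C] by [h \o p], which preserves [Z].
    This makes the intersection of [Z] and [X] available as a domain inside [X]. *)
Lemma subc_preimage X (hX : submodule_coalgebra X) Z :
  submodule_coalgebra Z -> submodule_coalgebra [set y : subc hX | Z (val y)].
Proof.
move=> hZ; have cZ := submodule_subcoalg hZ; have [_ _ ZB] := hZ.
have /subspaceP[Z0 ZL] := cZ.1; pose p := subc_proj hX.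
pose v := incl hX.
apply/submodule_coalgebraP; split; last first.
  move=> y b Zy; rewrite /= (_ : val _ = act (val y) b); last exact: subc_actE.
  exact: ZB.
have hitE (h : {linear subc hX -> k^o}) y :
    val (hitr h (comult y)) = hitr (h \o p) (comult (val y)) /\
    val (hitl h (comult y)) = hitl (h \o p) (comult (val y)).
  rewrite /hitr /hitl -(subc_comultE y); split.
    rewrite [RHS](tlift_tmap v v _ (hitr_bilin C (h \o p))) (linear_tlift v).
    by apply: tlift_eq => a b; rewrite linearZ_LR /= /p subc_projK.
  rewrite [RHS](tlift_tmap v v _ (hitl_bilin C (h \o p))) (linear_tlift v).
  by apply: tlift_eq => a b; rewrite linearZ_LR /= /p subc_projK.
apply: subcoalgI => [|h y Zy|h y Zy].
- apply/subspaceP; split=> [|a u w Zu Zw]; first by rewrite /mkset (linear0 v).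
  by rewrite /mkset (linearP v); exact: ZL.
- by rewrite /= (hitE h y).1; exact: subcoalg_hitr.
- by rewrite /= (hitE h y).2; exact: subcoalg_hitl.
Qed.

Lemma submodule_addspan (I : Type) (X : I -> set C) :
  (forall i, submodule_coalgebra (X i)) ->
  submodule_coalgebra (addspan (\bigcup_i X i)).
Proof.
move=> hX; apply/submodule_coalgebraP.
have cS : subcoalg (addspan (\bigcup_i X i)).
  by apply: subcoalg_addspan => i; exact: submodule_subcoalg.
split=> // c b; pose m := mklin ((@act_bilin k B C).1 b).
apply: (addspan_min (X := [set x | addspan (\bigcup_i X i) (m x)])).
  have /subspaceP[S0 SL] := cS.1.
  apply/subspaceP; split=> [|a u v Su Sv]; first by rewrite /mkset (linear0 m).
  by rewrite /mkset (linearP m); exact: SL.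
move=> x [i _ Xx]; apply: addspan_mem; exists i => //.
by have [_ _ XB] := hX i; exact: XB.
Qed.

(** The inverses agree on the intersection by uniqueness, so both the maps and their inverses glue;
    [B]-linearity and invertibility are linear conditions and pass from [Z] and [X] to their sum. *)
Lemma cocleft_join X Z f0 g0 f1 g1 :
  submodule_coalgebra Z -> submodule_coalgebra X ->
  cocleft_on Z f0 g0 -> cocleft_on X f1 g1 ->
  (forall c, Z c -> X c -> f1 c = f0 c) ->
  exists f g,
    cocleft_on (addspan (\bigcup_b (fun b : bool => if b then Z else X) b)) f g /\
    forall c, Z c -> f c = f0 c.
Proof.
move=> hZ hX [m0 i0] [m1 i1] f10.
have [cZ cX] := (submodule_subcoalg hZ, submodule_subcoalg hX).
have cZX := subcoalg_cap cZ cX.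
have g10 c : Z c -> X c -> g0 c = g1 c.
  move=> Zc Xc; apply: (inverse_unique cZX (f := f0)) => // {Zc Xc}c [Zc Xc].
    exact: (i0 c Zc).2.
  rewrite -[RHS](i1 c Xc).1.
  by apply: (conv_local (f := f0) (g := g1) cZX) => // y [Zy Xy]; rewrite f10.
have [f [fZ fX]] := linear_glue cZ.1 cX.1 (fun c Zc Xc => esym (f10 c Zc Xc)).
have [g [gZ gX]] := linear_glue cZ.1 cX.1 g10.
exists f, g; split=> //.
have iZ : inv_on Z f g.
  by apply: inv_on_eq i0 => // x Zx; rewrite ?fZ ?gZ.
have iX : inv_on X f g.
  by apply: inv_on_eq i1 => // x Xx; rewrite ?fX ?gX.
split=> c.
  move=> b; pose ma := mklin ((@act_bilin k B C).1 b).
  pose mb := mklin ((bilin_mul B).1 b).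
  apply: (addspan_min (X := [set x | (f \o ma) x = (mb \o f) x])).
    apply/subspaceP; split=> [|a u v]; first by rewrite /mkset !linear0.
    move=> fu fv; rewrite /mkset linearP [RHS]linearP.
    by congr (_ *: _ + _).
  have [_ _ ZB] := hZ; have [_ _ XB] := hX.
  move=> x [[] _ /= xZ]; first by rewrite !fZ ?m0 //; exact: ZB.
  by rewrite !fX ?m1 //; exact: XB.
apply: (addspan_min (X := [set c | conv f g c = conv1 B c /\
                                   conv g f c = conv1 B c])).
  apply/subspaceP; split=> [|a u v [fu gu] [fv gv]]; first by split; rewrite !linear0.
  by split; rewrite linearP [RHS]linearP; congr (_ *: _ + _).
by move=> x [[] _ /= xZ]; [exact: iZ|exact: iX].
Qed.

Lemma cocleft_sum (I : Type) (X : I -> set C) :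
  (forall i, is_subcoalgebra_in (@cocleft k B) (X i)) ->
  is_subcoalgebra_in (@cocleft k B) (addspan (\bigcup_i X i)).
Proof.
move=> RX; have hX i : submodule_coalgebra (X i) by have [] := RX i.
have fgX i : exists f g, cocleft_on (X i) f g.
  by have [h /cocleft_subcP] := RX i.
have hS := submodule_addspan hX; exists hS; apply/cocleft_subcP.
pose T (b : B) (c : C) : C := act c b; pose S (b a : B) := a * b.
pose O : set C := [set 0].
have sO : subspace O.
  by apply/subspaceP; split=> // a u v -> ->; rewrite scaler0 addr0.
have cO : subcoalg O.
  split=> // _ ->; rewrite linear0.
  by have /subspaceP[] := tens_set_subspace (V := C) (W := C) O sO.
have [||Z [f [g [[cZ iZ eZ] _ _ Zmax]]]] :=
  @maximal_inverse k C B B T S O \0 \0 cO.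
- by move=> c ->; rewrite !linear0.
- move=> b c ->; split=> /=; last by rewrite /S mul0r.
  exact: (bilin0l (@act_bilin k B C)).
have mZ : module_on Z f by move=> c b Zc; exact: (eZ b c Zc).2.
have hZ : submodule_coalgebra Z.
  by apply/submodule_coalgebraP; split=> // c b Zc; exact: (eZ b c Zc).1.
exists f, g; apply: cocleft_on_sub (conj mZ iZ).
apply: addspan_min cZ.1 _ => c [i _ Xc].
have [fi [gi ci]] := fgX i; have [_ _ XB] := hX i; set p := subc_proj (hX i).
have ciT : cocleft_on [set: subc (hX i)] (fi \o incl (hX i)) (gi \o incl (hX i)).
  by apply: cocleft_on_sub (cocleft_on_incl (hX i) ci) => y _; exact: subcP.
(* The maximal [f] is restricted to the intersection of [Z] with [X i] and extended over [X i];
   [cocleft_join] then enlarges the domain by [X i]. *)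
have [f1 [g1 [c1 f1E]]] := extend_cocleft (subc_preimage (hX i) hZ)
  (cocleft_on_incl (hX i) (conj mZ iZ)) ciT.
have [y Zy Xy|f' [g' [[mf' if'] f'E]]] :=
    cocleft_join hZ (hX i) (conj mZ iZ) (cocleft_on_proj c1).
  by rewrite /= f1E /= subc_projE.
set ZX := addspan _ in mf' if'.
have hZX : submodule_coalgebra ZX by apply: submodule_addspan => -[].
apply: (Zmax ZX f' g' (submodule_subcoalg hZX) if') => //.
- move=> b y ZXy; split; last exact: mf'.
  by have [_ _ ZXB] := hZX; exact: ZXB.
- by move=> y Zy; apply: addspan_mem; exists true.
- by apply: addspan_mem; exists false.
Qed.

End SubmoduleTransfer.

(** * Cointegrals on wedges *)

Section Wedge.
Variables (k : fieldType) (B : bialgType k) (C : modCoalgType B).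
Implicit Types (X Y : set C).

(** At c b, the product f * g becomes a sum over [comult b] of products of the functionals f(- u)
    and g(- v) at c, and these still vanish on [X] and [Y]. *)
Lemma submodule_wedge X Y : submodule_coalgebra X -> submodule_coalgebra Y ->
  submodule_coalgebra (wedge X Y).
Proof.
move=> hX hY; have [cX cY] := (submodule_subcoalg hX, submodule_subcoalg hY).
apply/submodule_coalgebraP; split; first exact: wedge_subcoalg.
have [[_ _ XB] [_ _ YB]] := (hX, hY).
move=> c b /(wedgeP _ cX.1 cY.1) cW; apply/(wedgeP _ cX.1 cY.1) => f g fX gY.
rewrite [LHS](tlift_comult_act _ _ (conv_bilin f g)) tlift_exchange.
apply: tlift_eq0 => u v.
pose fu := f \o mklin ((@act_bilin k B C).1 u).
pose gv := g \o mklin ((@act_bilin k B C).1 v).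
apply: (cW fu gv) => [x Xx|y Yy]; first exact/fX/XB.
exact/gY/YB.
Qed.

Variables (Z : set C) (f g : {linear C -> B}).
Hypotheses (hZ : submodule_coalgebra Z) (cl : cocleft_on Z f g).
Let W := wedge Z Z.

(** Here [comult w] lies in W ⊗ W and in Z ⊗ C + C ⊗ Z; projecting all factors onto [W] leaves Z ⊗ W
    + W ⊗ Z. Bilinear identities on [W] can thus be checked with one argument in [Z]. *)
Lemma tlift_wedge0 (U : lmodType k) (F : C -> C -> U) w : bilin F ->
  (forall x y, Z x -> W y -> F x y = 0) -> (forall x y, W x -> Z y -> F x y = 0) ->
  W w -> tlift F (comult w) = 0.
Proof.
move=> bF F1 F2 Ww; have cZ := submodule_subcoalg hZ.
have cW : subcoalg W by exact: wedge_subcoalg.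
have ZW : Z `<=` W by exact: (sub_wedge cZ cZ.1).
have [p [pW pid]] := subspace_retraction cW.1.
have bFp := bilin_comp idfun p p bF.
transitivity (tlift (fun x y => F (p x) (p y)) (comult w)).
  by apply: (tlift_local bF bFp _ (cW.2 w Ww)) => x y Wx Wy; rewrite /= !pid.
have [s [t [sZ tZ ->]]] := Ww; rewrite tlift_add //.
rewrite (tlift_local0 bFp _ sZ) ?(tlift_local0 bFp _ tZ) ?addr0 //.
  by move=> x y _ Zy; rewrite /= [p y]pid; [exact: F2|exact: ZW].
by move=> x y Zx _; rewrite /= [p x]pid; [exact: F1|exact: ZW].
Qed.

(* W/Z is a Hopf module over Z, hence is free over B; splitting it off extends
   f to W.  The splitting W/Z -> W is induced by w |-> q(w_1 g(w_2)) f(w_3). *)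
Lemma extend_wedge :
  exists f1 : {linear C -> B}, module_on W f1 /\ forall x, Z x -> f1 x = f x.
Proof.
have [[mf ig] [_ ZD ZB]] := (cl, hZ); have cZ := submodule_subcoalg hZ.
have ab := @act_bilin k B C.
have cW : subcoalg W by exact: wedge_subcoalg.
have [_ _ WB] := submodule_wedge hZ hZ.
have [r [rZ rid]] := subspace_retraction cZ.1.
(* The kernel of [q] is [Z], so [q] stands for the quotient map onto C / Z. *)
pose q : {linear C -> C} := idfun \- r.
have q0 x : Z x -> q x = 0 by move=> Zx; rewrite /q /= rid // subrr.
have qZ x : q x = 0 -> Z x by rewrite /q /= => /subr0_eq ->; exact: rZ.
have qact x a : q (act (q x) a) = q (act x a).
  have -> : q x = x - r x by [].
  by rewrite (bilinBl ab) linearB [X in _ - X]q0 ?subr0 //; exact: ZB.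
(* Modulo [Z], the projection of the Hopf module W / Z onto its coinvariants. *)
pose P : {linear C -> C} := q \o coinv g.
have PZ x : Z x -> P x = 0.
  move=> Zx; rewrite -[P x]/(q (coinv g x)) /coinv linear_tlift.
  apply: (tlift_local0 _ _ (ZD x Zx)).
    exact: (bilin_comp q idfun g ab).
  by move=> u v Zu _; apply/q0/ZB.
have Pact x b : W x -> P (act x b) = (counit b : k) *: P x.
  move=> Wx; apply: subr0_eq; rewrite -[P _]/(q (coinv g _)) coinv_act.
  rewrite -[P x]/(q (coinv g x)) -linearZ_LR -linearB.
  (* The defect of the identity [twistE], which holds on [Z]: a term with left argument in [Z] is
     killed by [q], one with right argument in [Z] by [d]. *)
  pose d : {linear C -> B} := twist g b \- (counit b : k) \*: g.
  transitivity (tlift (fun u v => q (act u (d v))) (comult x)); last first.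
    apply: (tlift_wedge0 _ _ _ Wx) => [|u v Zu _|u v _ Zv].
    - exact: (bilin_comp q idfun d ab).
    - exact/q0/ZB.
    - have -> : d v = 0 by rewrite /d /= (twistE b hZ cl Zv) subrr.
      by rewrite (bilin0r ab) linear0.
  rewrite -linear_tlift; congr (q _).
  rewrite /coinv /tlift /fsum scaler_sumr -sumrB; apply: eq_bigr => p _.
  by rewrite /d /= (bilinBr ab) (bilinZr ab).
have bs := bilin_comp idfun P f ab.
have sL : linear (fun w => tlift (fun x y => act (P x) (f y)) (comult w)).
  by move=> a x y; rewrite linearP (tlift_linear bs).
pose s := mklin sL.
have sZ x : Z x -> s x = 0.
  move=> Zx; apply: (tlift_local0 bs _ (ZD x Zx)) => u v Zu _.
  by rewrite -[LHS]/(act (P u) (f v)) PZ // (bilin0l ab).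
(* [f] is known to be [B]-linear on [Z] only. Terms with left argument in [Z] are killed by [P], and
   the others may be taken with right argument in [Z]. *)
have sact w b : W w -> s (act w b) = act (s w) b.
  move=> Ww; pose m := mklin (ab.1 b).
  have bL := bilin_act2 (comult b) bs; have bR := bilin_comp m P f ab.
  rewrite [LHS](tlift_comult_act _ _ bs) -[RHS]/(m (s w)) [RHS](linear_tlift m).
  apply: subr0_eq; rewrite /tlift -sumrB.
  pose F x y := tlift (fun u v => act (P (act x u)) (f (act y v))) (comult b)
    - m (act (P x) (f y)).
  have bF : bilin F.
    split=> [y|x] a z z'; rewrite /F.
      by rewrite (bL.1 y a z z') (bR.1 y a z z') opprD addrACA -scalerBr.
    by rewrite (bL.2 x a z z') (bR.2 x a z z') opprD addrACA -scalerBr.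
  apply: (tlift_wedge0 bF _ _ Ww) => x y.
    move=> Zx _; rewrite /F PZ // (bilin0l ab) linear0 subr0.
    by apply: tlift_eq0 => u v; rewrite PZ ?(bilin0l ab) //; exact: ZB.
  move=> Wx Zy; apply/eqP; rewrite /F subr_eq0; apply/eqP.
  pose l := mklin (ab.2 (P x)) \o mklin ((bilin_mul B).2 (f y)).
  rewrite -[m _]/(act _ b) actA -[RHS]/(l b) -[in RHS](counitl b).
  rewrite [RHS](linear_tlift l).
  apply: tlift_eq => u v; rewrite Pact // mf // linearZ_LR /=.
  by rewrite (bilinZl ab).
(* Modulo [Z], w - s(w) is w_1 d(w_2) with [d] the defect of g * f from the counit, which vanishes
   on [Z]. *)
have qs w : W w -> q (w - s w) = 0.
  move=> Ww; pose d : {linear C -> B} := conv1 B \- conv g f.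
  transitivity (tlift (fun x y => q (act x (d y))) (comult w)); last first.
    apply: (tlift_wedge0 _ _ _ Ww) => [|x y Zx _|x y _ Zy].
    - exact: (bilin_comp q idfun d ab).
    - exact/q0/ZB.
    - have -> : d y = 0 by rewrite /d /= (ig y Zy).2 subrr.
      by rewrite (bilin0r ab) linear0.
  have -> : tlift (fun x y => q (act x (d y))) (comult w) =
      tlift (fun x y => q (act x (conv1 B y))) (comult w) -
      tlift (fun x y => q (act x (conv g f y))) (comult w).
    rewrite /tlift /fsum -sumrB; apply: eq_bigr => p _.
    by rewrite (bilinBr ab) linearB.
  rewrite linearB; congr (_ - _).
    rewrite -[in LHS](counitr w) linear_tlift; apply: tlift_eq => x y.
    by rewrite /conv1 (bilinZr ab) act1.
  transitivity (tlift (fun x y => tlift (fun u v => q (act (act u (g v)) (f y)))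
      (comult x)) (comult w)).
    rewrite linear_tlift; apply: tlift_eq => x y.
    rewrite -[P x]/(q (coinv g x)) qact.
    by rewrite -linear_tlift; congr (q _); exact: (linear_tlift (mklin (ab.1 (f y)))).
  rewrite coassoc_tlift => [|y z a u v|x z a u v|x y a u v]; first 1 last.
  - by rewrite !ab.1 linearP.
  - by rewrite linearP ab.2 ab.1 linearP.
  - by rewrite linearP ab.2 linearP.
  apply: tlift_eq => x y; rewrite -linear_tlift; congr (q _).
  rewrite [RHS](linear_tlift (mklin (ab.2 x))).
  by apply: tlift_eq => u v; rewrite actA.
(* On [W], [idfun \- s] is a [B]-linear retraction onto [Z]. *)
exists (f \o (idfun \- s)); split=> [w b Ww|x Zx]; last first.
  by rewrite -[LHS]/(f (x - s x)) sZ ?subr0.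
rewrite -[LHS]/(f (act w b - s (act w b))) (sact _ _ Ww) -(bilinBl ab) mf //.
exact/qZ/qs.
Qed.

Lemma cocleft_wedge : exists f1 g1, cocleft_on W f1 g1.
Proof.
have [f1 [m1 f1E]] := extend_wedge; have cZ := submodule_subcoalg hZ.
have i1 : inv_on Z f1 g.
  by apply: inv_on_eq cl.2 => // x Zx; rewrite f1E.
by have [g1 iW] := wedge_inv cZ i1; exists f1, g1.
Qed.

End Wedge.

(** * The zero coalgebra, witnessing non-emptiness *)

Section ZeroCoalgebra.
Variables (k : fieldType) (B : bialgType k).

Lemma zero_cocleft : exists C : modCoalgType B, cocleft C.
Proof.
pose V : lmodType k := 'rV[k]_0.
have V0 (x y : V) : x = y by rewrite (thinmx0 x) (thinmx0 y).
pose d : {linear V -> (V ⊗ V)%type} := \0.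
pose e : {linear V -> k^o} := \0.
have dA c : tassoc (tmap d idfun (d c)) = tmap idfun d (d c).
  by rewrite !(linear0 (tmap _ _)) linear0.
have eL c : tlift (fun x y => e x *: y) (d c) = c by exact: V0.
have eR c : tlift (fun x y => e y *: x) (d c) = c by exact: V0.
pose D : coalgType k := HB.pack V (Lmodule_isCoalgebra.Build k V dA eL eR).
pose a (c : D) (b : B) : D := 0.
have ab : bilin a by split=> [b|c] x y z; exact: V0.
have aA c x y : a (a c x) y = a c (x * y) by [].
have a1 c : a c 1 = c by exact: V0.
have ad c b : comult (a c b) = tmap2 a a (comult c) (comult b).
  by rewrite -[comult c]/(0 : (D ⊗ D)%type) (bilin0l (tmap2_bilin ab ab)).
have ae c b : counit (a c b) = counit c * counit b.
  by rewrite -[counit c]/(0 : k) mul0r.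
pose C : modCoalgType B :=
  HB.pack D (Coalgebra_isModuleCoalgebra.Build k B D ab aA a1 ad ae).
exists C, \0; split=> [c b|]; first by rewrite /= mul0r.
exists \0 => c; rewrite -[counit c]/(0 : k) scale0r.
by split; apply: tlift_eq0 => x y; rewrite mul0r.
Qed.

End ZeroCoalgebra.

Theorem theorem5p3 (k : fieldType) (B : bialgType k) :
  idempotent_radical_class (@cocleft k B).
Proof.
split; first split.
- exact: zero_cocleft.
- move=> C X hX [f [mf [g ig]]]; apply/cocleft_subcP; exists f, g.
  by split=> [c b _|c _]; [exact: mf|exact: ig].
- by move=> C I X; exact: cocleft_sum.
move=> C X Y RX RY; have [[hX _] [hY _]] := (RX, RY).
exists (submodule_wedge hX hY); apply/cocleft_subcP.
(* Both factors of the wedge are enlarged to their sum [Z], which is cocleft by [cocleft_sum]; the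
   cointegral on the wedge square of [Z] then restricts. *)
pose Z := addspan (\bigcup_b (fun b : bool => if b then X else Y) b).
have [|hZ /cocleft_subcP[f [g cl]]] := @cocleft_sum k B C bool
  (fun b => if b then X else Y); first by case.
have [f1 [g1 cW]] := cocleft_wedge hZ cl; exists f1, g1.
apply: cocleft_on_sub cW; apply: wedgeS => x Xx; apply: addspan_mem.
  by exists true.
by exists false.
Qed.
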